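(* Let $C\subset\mathbb{P}^2$ be a rational curve given by a proper parameterization $\mathbf f=(f_0:f_1:f_2)$, $f_u=\sum_{j=0}^n a_{uj}s^{n-j}t^j\in K[s,t]_n$, $n\ge3$, with associated schemes $X_2,\dots,X_{n-1}$ (see the context). For each $k=2,\dots,n-1$ compute successively: (i) $I_{Z_k}=\sqrt{I_{X_k}}\subset K[x_0,\dots,x_k]$, where $I_{X_k}$ is the ideal of the $(n-k+3)$-minors of $M_k$; (ii) in $K[x_0,\dots,x_k,z_0,\dots,z_n]$, the ideal $I$ generated by $I_{Z_k}$ and by $\sum_{i=0}^k x_iz_{i+j}$, $j=0,\dots,n-k$; (iii) the saturation $I'$ of $I$ with respect to $(x_0,\dots,x_k)$; (iv) the elimination ideal $I_{L_k}=I'\cap K[z_0,\dots,z_n]$; (v) in $K[z_0,\dots,z_n,w_0,w_1,w_2]$, the ideal $I''$ generated by $I_{L_k}$ and by $w_u-\sum_{j=0}^n a_{uj}z_j$, $u=0,1,2$; (vi) the elimination ideal $I''\cap K[w_0,w_1,w_2]$ and its radical $J_{\ge k}$. Put $J_{\ge n}=(1)$ and $J_k=J_{\ge k}:J_{\ge k+1}$ for $2\le k\le n-1$. Then $J_{\ge 2}\subset K[w_0,w_1,w_2]$ is the radical ideal of the reduced set $\operatorname{Sing}(C)\subset\mathbb{P}^2$ and, for each $k=2,\dots,n-1$, $J_k$ is the radical ideal of the reduced set $\operatorname{Sing}_k(C)$ of points of $C$ of multiplicity exactly $k$. In particular the cardinality $N$ of $\operatorname{Sing}(C)$ and the cardinality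 $N_k$ of $\operatorname{Sing}_k(C)$ are given by the (constant) Hilbert polynomials of $K[w_0,w_1,w_2]/J_{\ge2}$ and $K[w_0,w_1,w_2]/J_k$, respectively.
   Context: $K$ is an algebraically closed field of characteristic $0$, $\mathbb{P}^2=\mathbb{P}^2_K$ with coordinates $w_0,w_1,w_2$. Proper means: $\mathbf f:\mathbb{P}^1\to\mathbb{P}^2$ is generically $1:1$ onto $C$ and the $f_u$ have no common zeroes. For $2\le k\le n-1$, $M_k$ is the $(n-k+4)\times(n+1)$ matrix (columns numbered $0,\dots,n$) whose first $n-k+1$ rows are indexed by $i=0,\dots,n-k$, the $i$-th having entries $x_0,\dots,x_k$ in columns $i,\dots,i+k$ and $0$ elsewhere, and whose last three rows are $(a_{u0},\dots,a_{un})$, $u=0,1,2$. $X_k\subset\mathbb{P}^k$ is the scheme defined by the $(n-k+3)$-minors of $M_k$. $\operatorname{Sing}_k(C)=\{P\in C\mid P \text{ is singular of multiplicity } k\}$. The radical ideal of a finite set of points of $\mathbb{P}^2$ is the homogeneous ideal of all polynomials vanishing on it (the unit ideal for the empty set). *)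

(* Defs.v *)
From HB Require Import structures.
From mathcomp Require Import all_boot all_order all_algebra.
From mathcomp Require Import mpoly.
Set Implicit Arguments.
Unset Strict Implicit.
Unset Printing Implicit Defensive.
Import GRing.Theory.
Local Open Scope ring_scope.

(* Ideals are Prop-valued predicates: the [idealr] structure of MathComp is
   restricted to decidable proper ideals, whereas unit ideals occur here. *)
Section Ideals.
Variable R : comNzRingType.
Implicit Types I J S : R -> Prop.

Definition ideal_gen S : R -> Prop := fun p =>
  exists2 s : seq (R * R), (forall x, x \in s -> S x.2) &
    p = \sum_(x <- s) x.1 * x.2.

Definition unit_ideal : R -> Prop := fun _ => True.

Definition radical I : R -> Prop := fun p => exists m : nat, I (p ^+ m).

Definition colon I J : R -> Prop := fun p => forall q, J q -> I (p * q).

Definition ideal_mul I J : R -> Prop :=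
  ideal_gen (fun p => exists x y, [/\ I x, J y & p = x * y]).

Definition ideal_exp I (m : nat) : R -> Prop := iter m (ideal_mul I) unit_ideal.

Definition saturation I J : R -> Prop := fun p =>
  exists m : nat, colon I (ideal_exp J m) p.
End Ideals.

Definition irreducible_elt (R : unitRingType) (p : R) : Prop :=
  [/\ p != 0, p \isn't a GRing.unit &
      forall q r, p = q * r -> q \is a GRing.unit \/ r \is a GRing.unit].

(* K[y_0, .., y_(l-1)] and K[y_l, .., y_(l+m-1)] inside K[y_0, .., y_(l+m-1)] *)
Definition lvars (K : fieldType) (l m : nat) (p : {mpoly K[l]}) :
    {mpoly K[l + m]} := p \mPo [tuple 'X_(lshift m i) | i < l].
Definition rvars (K : fieldType) (l m : nat) (p : {mpoly K[m]}) :
    {mpoly K[l + m]} := p \mPo [tuple 'X_(rshift l i) | i < m].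

Section Projective.
Variable K : fieldType.

(* Points of P^m are the lines through the origin of K^(m+1). *)
Definition pspace (m : nat) := {U : {vspace 'rV[K]_m.+1} | \dim U == 1%N}.

Definition vanishes_at (m : nat) (p : {mpoly K[m.+1]}) (P : pspace m) : Prop :=
  forall v : 'rV[K]_m.+1, v \in val P -> p.@[v 0] = 0.

Definition vanishing_ideal (m : nat) (S : pspace m -> Prop) :
    {mpoly K[m.+1]} -> Prop :=
  ideal_gen (fun p => (exists d : nat, p \is d.-homog) /\
                      (forall P, S P -> vanishes_at p P)).

Definition has_card (m : nat) (S : pspace m -> Prop) (N : nat) : Prop :=
  exists s : seq (pspace m),
    [/\ uniq s, forall P, P \in s <-> S P & size s = N].

(* r is the dimension of the degree d part of K[y_0, .., y_(m-1)] / I, for a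
   homogeneous ideal I: some r forms of degree d induce a basis. *)
Definition hilbert_fun (m : nat) (I : {mpoly K[m]} -> Prop) (d r : nat) : Prop :=
  exists2 b : 'I_r -> {mpoly K[m]}, (forall i, b i \is d.-homog) &
    forall p : {mpoly K[m]}, p \is d.-homog ->
      exists! c : 'rV[K]_r, I (p - \sum_(i < r) c 0 i *: b i).

Definition hilbert_poly (m : nat) (I : {mpoly K[m]} -> Prop) (h : {poly rat}) :
    Prop :=
  exists d0 : nat, forall d : nat, (d0 <= d)%N ->
    exists2 r : nat, hilbert_fun I d r & h.[d%:R] = r%:R.

(* A reduced irreducible plane curve, given by its equation. *)
Definition plane_curve (F : {mpoly K[3]}) : Prop :=
  (exists d : nat, F \is d.-homog) /\ irreducible_elt F.

Definition Sing (F : {mpoly K[3]}) (P : pspace 2) : Prop :=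
  vanishes_at F P /\ (forall u : 'I_3, vanishes_at F^`M(u) P).

(* The equation of the curve in the affine chart w_i = 1, translated so that
   the point v of that chart (v_i = 1) becomes the origin. *)
Definition local_equation (F : {mpoly K[3]}) (v : 'rV[K]_3) (i : 'I_3) :
    {mpoly K[3]} :=
  F \mPo [tuple (if j == i then (v 0 j)%:MP else 'X_j + (v 0 j)%:MP) | j < 3].

Definition order_at_origin (m : nat) (p : {mpoly K[m]}) (r : nat) : Prop :=
  (forall e : 'X_{1..m}, (mdeg e < r)%N -> p@_e = 0) /\
  (exists2 e : 'X_{1..m}, mdeg e = r & p@_e != 0).

Definition multiplicity (F : {mpoly K[3]}) (P : pspace 2) (r : nat) : Prop :=
  exists (v : 'rV[K]_3) (i : 'I_3),
    [/\ v \in val P, v 0 i = 1 & order_at_origin (local_equation F v i) r].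

Definition Sing_mult (F : {mpoly K[3]}) (k : nat) (P : pspace 2) : Prop :=
  Sing F P /\ multiplicity F P k.
End Projective.

Section Parameterization.
Variables (K : fieldType) (n : nat) (a : 'M[K]_(3, n.+1)).

(* The variables s, t of K[s, t] are 'X_0 and 'X_1. *)
Definition param_form (u : 'I_3) : {mpoly K[2]} :=
  \sum_(j < n.+1) a u j *: ('X_0 ^+ (n - j) * 'X_1 ^+ j).

Definition param_vec (v : 'rV[K]_2) : 'rV[K]_3 := \row_u (param_form u).@[v 0].

(* P is the image of Q; when the forms have no common zero, this does not
   depend on the representative [vpick (val Q)] and P always exists. *)
Definition param_image (Q : pspace K 1) (P : pspace K 2) : Prop :=
  val P = <[param_vec (vpick (val Q))]>%VS.

Definition proper_param (F : {mpoly K[3]}) : Prop :=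
  [/\ forall Q : pspace K 1, ~ (forall u, vanishes_at (param_form u) Q),
      forall P, vanishes_at F P <-> exists Q, param_image Q P &
      exists B : seq (pspace K 2), forall P, vanishes_at F P -> P \notin B ->
        exists! Q, param_image Q P].

Definition Mmat (k : nat) : 'M[{mpoly K[k.+1]}]_((n - k).+1 + 3, n.+1) :=
  col_mx (\matrix_(i, j) if (i <= j <= i + k)%N then 'X_(inord (j - i)) else 0)
         (map_mx (@mpolyC k.+1 K) a).

Definition is_minor (R : comNzRingType) (p q r : nat) (M : 'M[R]_(p, q))
    (x : R) : Prop :=
  exists (f : 'I_r -> 'I_p) (g : 'I_r -> 'I_q),
    [/\ forall i j : 'I_r, (i < j)%N -> (f i < f j)%N,
        forall i j : 'I_r, (i < j)%N -> (g i < g j)%N &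
        x = \det (mxsub f g M)].

Definition ideal_X (k : nat) : {mpoly K[k.+1]} -> Prop :=
  ideal_gen (is_minor (n - k + 3) (Mmat k)).

Definition ideal_Z (k : nat) : {mpoly K[k.+1]} -> Prop := radical (@ideal_X k).

(* In K[x_0, .., x_k, z_0, .., z_n], x_i is 'X_(lshift n.+1 i) and z_j is
   'X_(rshift k.+1 j). *)
Definition ideal_xz (k : nat) : {mpoly K[k.+1 + n.+1]} -> Prop :=
  ideal_gen (fun p =>
    (exists2 q, @ideal_Z k q & p = lvars n.+1 q) \/
    (exists2 j : nat, (j <= n - k)%N &
       p = \sum_(i < k.+1)
             'X_(lshift n.+1 i) * 'X_(rshift k.+1 (inord (i + j))))).

Definition ideal_xz_sat (k : nat) : {mpoly K[k.+1 + n.+1]} -> Prop :=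
  saturation (@ideal_xz k)
    (ideal_gen (fun p => exists i : 'I_k.+1, p = 'X_(lshift n.+1 i))).

Definition ideal_L (k : nat) : {mpoly K[n.+1]} -> Prop :=
  fun p => @ideal_xz_sat k (rvars k.+1 p).

(* In K[z_0, .., z_n, w_0, w_1, w_2], z_j is 'X_(lshift 3 j) and w_u is
   'X_(rshift n.+1 u). *)
Definition ideal_zw (k : nat) : {mpoly K[n.+1 + 3]} -> Prop :=
  ideal_gen (fun p =>
    (exists2 q, ideal_L k q & p = lvars 3 q) \/
    (exists u : 'I_3,
       p = 'X_(rshift n.+1 u) - \sum_(j < n.+1) a u j *: 'X_(lshift 3 j))).

Definition Jge (k : nat) : {mpoly K[3]} -> Prop :=
  if (k < n)%N then radical (fun p => ideal_zw k (rvars n.+1 p))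
  else @unit_ideal {mpoly K[3]}.

Definition Jeq (k : nat) : {mpoly K[3]} -> Prop := colon (Jge k) (Jge k.+1).
End Parameterization.

(* Main.v *)
Require Import Defs.
From HB Require Import structures.
From Stdlib Require Import Classical.
From mathcomp Require Import all_boot all_order all_algebra.
From mathcomp Require Import perm separable ring zify.
From mathcomp Require Import mpoly.
Set Implicit Arguments.
Unset Strict Implicit.
Unset Printing Implicit Defensive.
Import GRing.Theory.
Local Open Scope ring_scope.

(* The multiplicity of P on C is the degree of the greatest common divisor of
   the pullbacks to P^1 of the lines through P: on a generic line through P, the
   points of C other than P are counted by their parameters (properness and
   characteristic 0 give distinct ones) and by the roots of the equation of C
   (irreducible, hence squarefree over the function field of the pencil of
   lines).  So P has multiplicity at least k if and only if some form g of
   degree k divides the pullbacks of all the lines through P, that is, if and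
   only if M_k has rank at most n - k + 2 at the coefficient vector x of g, for
   some such g.  For x in Z_k, the linear space of the z with
   sum_i x_i z_(i+j) = 0 is dual to the multiples of g, hence is mapped by the
   a_u onto the line P of K^3.  By the Nullstellensatz the elimination therefore
   produces the ideal of the points of multiplicity at least k.  These are
   finitely many for k >= 2, and a finite set of N points imposes independent
   conditions on forms of degree at least N. *)

(** * Evaluation of polynomials *)

(** Binary forms of degree k are handled as univariate polynomials of size at most k + 1, and a drop
    in size is a zero at the parameter (0:1). Hence the size bounds that accompany every factor, and
    the separate treatment of the image of (0:1). On the side of the equation, the lines through v
    are parameterized with v at infinity: the multiplicity at v is then the drop of the degree in z,
    and the two counts are compared root by root. Applied to a point off C, the same count shows
    that F has degree n, which turns n - mu = d - m into mu = m. Irreducibility of F has to be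
    transferred to polynomials in z over K[x]; a factorization there lifts to K[w_0, w_1, w_2] only
    after multiplication by linear forms vanishing at v. The eliminated ideals are not known
    beforehand to be homogeneous, so polynomials are tested at all vectors of a line through the
    origin, and the Nullstellensatz is used in its affine form. *)

Lemma closed_field_fresh (K : closedFieldType) (s : seq K) :
  exists x, x \notin s.
Proof.
case: s => [|y s]; first by exists 0.
(* [p + 1] takes the value 1 on the whole list, so its roots are new; it is not constant because the
   list is not empty. *)
pose p := \prod_(z <- y :: s) ('X - z%:P).
have sp : size (p + 1) = (size s).+2.
  by rewrite size_polyDl size_prod_XsubC // size_polyC oner_neq0.
have /closed_rootP [x] : size (p + 1) != 1 by rewrite sp.
rewrite rootE hornerD hornerC => /eqP px; exists x.
rewrite -root_prod_XsubC; apply/negP => /rootP; rewrite -/p => px0.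
by move/eqP: px; rewrite px0 add0r oner_eq0.
Qed.

Lemma poly_nz_point (K : closedFieldType) (p : {poly K}) (s : seq K) :
  p != 0 -> exists2 x, x \notin s & ~~ root p x.
Proof.
move=> p0; have [r er] := closed_field_poly_normal p.
have [x] := closed_field_fresh (s ++ r); rewrite mem_cat negb_or => /andP[xs xr].
exists x => //; rewrite er rootZ ?lead_coef_eq0 //.
by rewrite root_prod_XsubC.
Qed.

Lemma rmorph_mmap (n : nat) (R : nzRingType) (S T : comNzRingType)
    (f : {rmorphism R -> S}) (g : {rmorphism S -> T}) (h : 'I_n -> S)
    (p : {mpoly R[n]}) :
  g (mmap f h p) = mmap (g \o f) (g \o h) p.
Proof.
rewrite /mmap rmorph_sum; apply: eq_bigr => m _; rewrite rmorphM /=; congr (_ * _).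
by rewrite rmorph_prod; apply: eq_bigr => i _; rewrite rmorphXn.
Qed.

Lemma eq_mmap (n : nat) (R S : nzRingType) (f f' : R -> S) (h h' : 'I_n -> S) :
  f =1 f' -> h =1 h' -> mmap f h =1 mmap f' h'.
Proof.
move=> ef eh p; rewrite /mmap; apply: eq_bigr => m _.
by rewrite ef (mmap1_eq _ eh).
Qed.

Lemma mmap_comp_mpoly (n k : nat) (R S : comNzRingType)
    (f : {rmorphism R -> S}) (h : 'I_k -> S) (lq : n.-tuple {mpoly R[k]}) p :
  mmap f h (p \mPo lq) = mmap f (fun i => mmap f h (tnth lq i)) p.
Proof.
rewrite /comp_mpoly (rmorph_mmap _ (mmap f h)); apply: eq_mmap => //= c.
exact: mmapC.
Qed.

Lemma meval_mmap (n : nat) (K : comNzRingType) (v : 'I_n -> K) p :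
  p.@[v] = mmap idfun v p.
Proof. by []. Qed.

Lemma muni_eq0 (n : nat) (R : nzRingType) (p : {mpoly R[n.+1]}) :
  muni p = 0 -> p = 0.
Proof.
move=> p0; apply/mpolyP => m; rewrite mcoeff0.
have := congr1 (fun q : {poly {mpoly R[n]}} =>
  (q`_(m ord_max))@_[multinom m (widen_ord (leqnSn n) i) | i < n]) p0.
rewrite /= coef0 mcoeff0 => <-.
rewrite muniE coef_sum raddf_sum /= {1}[p]mpolyE raddf_sum /=.
apply: eq_bigr => m' _.
rewrite mcoeffZ mcoeffX coefZ coefXn -scalerAl mcoeffZ.
case: (eqVneq m' m) => [->|ne]; first by rewrite !eqxx !mulr1 mcoeffX eqxx mulr1.
rewrite mulr0; case: eqP => e1; last by rewrite mulr0 mcoeff0 mulr0.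
rewrite mulr1 mcoeffX; case: eqP => e2; last by rewrite mulr0.
case/eqP: ne; apply/mnmP => i.
case: (unliftP ord_max i) => [j ->|->]; last by rewrite e1.
have -> : lift ord_max j = widen_ord (leqnSn n) j.
  by apply: val_inj; rewrite /= /bump leqNgt ltn_ord.
by move/mnmP/(_ j): e2; rewrite !mnmE.
Qed.

Lemma meval_muni (n : nat) (K : comNzRingType) (p : {mpoly K[n.+1]}) w x :
  (map_poly (meval w) (muni p)).[x] =
  p.@[fun i => if unlift ord_max i is Some j then w j else x].
Proof.
rewrite muniE mevalE rmorph_sum /= horner_sum; apply: eq_bigr => m _.
rewrite map_polyZ hornerZ map_polyXn hornerXn /= mevalZ mevalX -mulrA; congr (_ * _).
rewrite big_ord_recr /= unlift_none; congr (_ * _); apply: eq_bigr => i _.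
have -> : widen_ord (leqnSn n) i = lift ord_max i.
  by apply: val_inj; rewrite /= /bump leqNgt ltn_ord.
rewrite liftK mnmE; congr (_ ^+ m _); apply: val_inj => /=.
by rewrite /bump leqNgt ltn_ord.
Qed.

(** Induction on the number of variables: at a point where the leading coefficient in the last
    variable does not vanish, a nonzero univariate polynomial remains. *)
Lemma mpoly_nz_point (K : closedFieldType) (n : nat) (p : {mpoly K[n]}) :
  p != 0 -> exists v : 'I_n -> K, p.@[v] != 0.
Proof.
elim: n p => [|n IH] p p0.
  exists (fun _ => 0); apply: contraNneq p0.
  by rewrite -{1}[p]mpolyKC mevalC -{2}[p]mpolyKC => ->; rewrite mpolyC0.
have : muni p != 0 by apply: contraNneq p0 => /muni_eq0 ->.
rewrite -lead_coef_eq0 => /IH [w wp].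
have : map_poly (meval w) (muni p) != 0.
  by rewrite -size_poly_eq0 size_map_poly_id0 // size_poly_eq0 -lead_coef_eq0;
     apply: contraNneq wp => ->; rewrite meval0.
case/(poly_nz_point [::]) => x _; rewrite rootE meval_muni => px.
by eexists; exact: px.
Qed.

Lemma mpoly_eq_eval (K : closedFieldType) (n : nat) (p q : {mpoly K[n]}) :
  (forall v, p.@[v] = q.@[v]) -> p = q.
Proof.
move=> pq; apply/eqP; rewrite -subr_eq0; apply/negPn/negP => /mpoly_nz_point.
by case=> v; rewrite mevalB pq subrr eqxx.
Qed.

(** * Ideals *)

Record is_ideal (R : comNzRingType) (I : R -> Prop) : Prop := IsIdeal {
  is_ideal0 : I 0;
  is_idealD : forall x y, I x -> I y -> I (x + y);
  is_idealMl : forall a x, I x -> I (a * x) }.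

Section IdealTheory.
Variables (R : comNzRingType) (I : R -> Prop).
Hypothesis idI : is_ideal I.

Lemma is_idealMr a x : I x -> I (x * a).
Proof. by rewrite mulrC; apply: is_idealMl. Qed.

Lemma is_idealN x : I x -> I (- x).
Proof. by rewrite -mulN1r; apply: is_idealMl. Qed.

Lemma is_idealB x y : I x -> I y -> I (x - y).
Proof. by move=> Ix Iy; apply: is_idealD => //; apply: is_idealN. Qed.

Lemma ideal_sum (T : eqType) (r : seq T) (P : pred T) (F : T -> R) :
  (forall i, i \in r -> P i -> I (F i)) -> I (\sum_(i <- r | P i) F i).
Proof.
move=> IF; rewrite big_seq_cond; elim/big_ind: _ => [||i /andP[]].
- exact: is_ideal0.
- exact: is_idealD.
- exact: IF.
Qed.

Lemma is_idealX x m e : (m <= e)%N -> I (x ^+ m) -> I (x ^+ e).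
Proof. by move=> /subnK <- Ix; rewrite exprD; apply: is_idealMl. Qed.
End IdealTheory.

Lemma ideal_gen_ideal (R : comNzRingType) (S : R -> Prop) : is_ideal (ideal_gen S).
Proof.
split=> [|x y [s sS ->] [t tS ->]|a x [s sS ->]].
- by exists [::] => //; rewrite big_nil.
- by exists (s ++ t); [move=> z; rewrite mem_cat => /orP[/sS|/tS]|rewrite big_cat].
- exists [seq (a * z.1, z.2) | z <- s]; first by move=> _ /mapP[z /sS zS ->].
  by rewrite big_map mulr_sumr; apply: eq_bigr => z _; rewrite mulrA.
Qed.

Lemma ideal_gen_sub (R : comNzRingType) (S I : R -> Prop) :
  is_ideal I -> (forall x, S x -> I x) -> forall x, ideal_gen S x -> I x.
Proof.
move=> idI SI x [s sS ->]; apply: ideal_sum => // z zs _.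
by apply: is_idealMl => //; apply/SI/sS.
Qed.

Lemma mem_ideal_gen (R : comNzRingType) (S : R -> Prop) x : S x -> ideal_gen S x.
Proof.
exists [:: (1, x)]; first by move=> z; rewrite inE => /eqP ->.
by rewrite big_seq1 mul1r.
Qed.

(** * Nullstellensatz *)

(** K[X] is principal: unless J is zero, a nonzero element of least size divides all the others, and
    it is not constant because 1 is not in J. *)
Lemma poly_ideal_root (K : closedFieldType) (J : {poly K} -> Prop) :
  is_ideal J -> ~ J 1 -> exists b, forall f, J f -> root f b.
Proof.
move=> idJ J1.
case: (classic (exists2 g, J g & g != 0)) => [[g0 Jg0 g00]|nJ]; last first.
  exists 0 => f Jf; have [->|f0] := eqVneq f 0; first exact: root0.
  by case: nJ; exists f.
have [g [Jg gn0 gmin]] : exists g, [/\ J g, g != 0 &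
    forall f, J f -> f != 0 -> (size g <= size f)%N].
  move: {2}(size g0) (leqnn (size g0)) => s; elim: s g0 Jg0 g00 => [|s IH] g Jg gn0.
    by rewrite leqn0 size_poly_eq0 (negbTE gn0).
  move=> gs; case: (classic (exists f, [/\ J f, f != 0 & (size f < size g)%N])).
    by case=> f [Jf fn0 fg]; apply: (IH f) => //; rewrite -ltnS (leq_trans fg).
  move=> nf; exists g; split=> // f Jf fn0; rewrite leqNgt; apply/negP => fg.
  by case: nf; exists f.
have /closed_rootP[b gb] : size g != 1.
  apply/negP => /size_poly1P[c c0 gc]; apply: J1.
  have -> : 1 = (c^-1)%:P * g by rewrite gc -polyCM mulVf.
  exact: is_idealMl.
exists b => f Jf; have fE := divp_eq f g.
have Jm : J (f %% g).
  have -> : f %% g = f - f %/ g * g by rewrite {2}fE addrC addKr.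
  by apply: is_idealB => //; apply: is_idealMl.
have [m0|mn0] := eqVneq (f %% g) 0; last first.
  by move: (gmin _ Jm mn0); rewrite leqNgt ltn_modp gn0.
by rewrite fE m0 addr0 rootM gb orbT.
Qed.

(** When both leading coefficients survive, the sizes do too, and the Sylvester matrix keeps its
    shape. *)
Lemma map_resultant_gen (R S : nzRingType) (f : {rmorphism R -> S}) p q :
    f (lead_coef p) != 0 -> f (lead_coef q) != 0 ->
  f (resultant p q) = resultant (map_poly f p) (map_poly f q).
Proof.
move=> fp fq; rewrite /resultant -det_map_mx /Sylvester_mx !size_map_poly_id0 //.
congr (\det _); rewrite map_col_mx.
by congr col_mx; apply: map_lin1_mx => v; rewrite map_poly_rV rmorphM /= map_rVpoly.
Qed.

(* Adding a high multiple of q to f keeps the leading coefficient under control,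
   so that the resultant commutes with ev. *)
Lemma resultant_avoids (K : fieldType) (R : idomainType)
    (ev : {rmorphism R -> K}) (f q : {poly R}) :
    (1 < size q)%N -> ev (lead_coef q) != 0 -> map_poly ev f = 1 ->
  exists r u v, r%:P = u * f + v * q /\ ev r != 0.
Proof.
move=> sq evq evf.
have q0 : q != 0 by rewrite -size_poly_gt0 (ltn_trans _ sq).
pose g := f + 'X^(size f) * q.
have lf : (size f < size ('X^(size f) * q)%R)%N.
  by rewrite mulrC size_mulXn // -[X in (X < _)%N]addn0 ltn_add2l (ltn_trans _ sq).
have sg : size g = size ('X^(size f) * q) by rewrite /g addrC size_polyDl.
have lg : lead_coef g = lead_coef q.
  by rewrite /g addrC lead_coefDl // lead_coefM lead_coefXn mul1r.
have sg1 : (1 < size g)%N.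
  rewrite sg mulrC size_mulXn //; apply: leq_trans sq _; exact: leq_addl.
have [[u v] /= _ e] := resultant_in_ideal sg1 sq.
exists (resultant g q), u, (u * 'X^(size f) + v); split.
  by rewrite e /g; ring.
rewrite map_resultant_gen ?lg // resultant_eq0 -leqNgt.
(* As [ev] sends f to 1, the images of g and q are coprime and their resultant is not 0. *)
have -> : map_poly ev g = 1 + 'X^(size f) * map_poly ev q.
  by rewrite /g rmorphD rmorphM /= map_polyXn evf.
set Q := map_poly ev q.
have : coprimep Q (1 + 'X^(size f) * Q).
  by rewrite addrC coprimep_addl_mul coprimep1.
by rewrite coprimep_sym /coprimep => /eqP ->.
Qed.

(** The coefficient is taken at the expected degree and not as [lead_coef], since some u i may have
    smaller degree. *)
Lemma coef_prod_linear (R : comNzRingType) (I : Type) (r : seq I)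
    (u : I -> {poly R}) (e : I -> nat) :
  (forall i, size (u i) <= 2)%N ->
  (size (\prod_(i <- r) u i ^+ e i)%R <= (\sum_(i <- r) e i).+1)%N /\
  (\prod_(i <- r) u i ^+ e i)`_(\sum_(i <- r) e i) = \prod_(i <- r) (u i)`_1 ^+ e i.
Proof.
move=> su.
have mulS (p q : {poly R}) d d' : (size p <= d.+1)%N -> (size q <= d'.+1)%N ->
    (size (p * q)%R <= (d + d').+1)%N /\ (p * q)`_(d + d') = p`_d * q`_d'.
  move=> sp sq; split.
    by apply: leq_trans (size_polyMleq _ _) _; lia.
  have dl : (d < (d + d').+1)%N by lia.
  rewrite coefM (bigD1 (Ordinal dl)) //= addKn big1 ?addr0 // => i ni.
  have {}ni : (i != d :> nat) by apply: contra ni => /eqP h; apply/eqP/val_inj.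
  case: (ltnP d i) => di; first by rewrite [p`__]nth_default ?mul0r //; exact: leq_trans sp di.
  by rewrite [q`__]nth_default ?mulr0 //; apply: leq_trans sq _; lia.
have expS (p : {poly R}) d : (size p <= 2)%N ->
    (size (p ^+ d)%R <= d.+1)%N /\ (p ^+ d)`_d = p`_1 ^+ d.
  move=> sp; elim: d => [|d [IH1 IH2]].
    by rewrite !expr0 size_poly1 coef1.
  by rewrite !exprS -IH2; apply: (mulS _ _ 1%N).
elim: r => [|i r [IH1 IH2]].
  by rewrite !big_nil size_poly1 coef1.
rewrite !big_cons -IH2; case: (expS (u i) (e i) (su i)) => e1 <-.
exact: mulS.
Qed.

Section WeakNullstellensatz.
Variables (K : closedFieldType) (A : comNzRingType) (iota : {rmorphism K -> A}).
Variables (I : A -> Prop).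
Hypotheses (idI : is_ideal I) (I1 : ~ I 1).

Lemma ideal_const (c : K) : I (iota c) -> c = 0.
Proof.
move=> Ic; apply/eqP/negPn/negP => c0; apply: I1.
by rewrite -(rmorph1 iota) -(mulVf c0) rmorphM; apply: is_idealMl.
Qed.

(* The generators are replaced by y_i - c_i y_n, where c is chosen off the
   zeros of the leading form of some relation: this makes y_n integral over
   the others. *)
Lemma weak_nullstellensatz (n : nat) (y : 'I_n -> A) :
  exists c : 'I_n -> K, forall p, I (mmap iota y p) -> p.@[c] = 0.
Proof.
elim: n y => [|n IH] y.
  exists (fun _ => 0) => p; rewrite -[p]mpolyKC mmapC mevalC.
  exact: ideal_const.
(* Without a nonzero relation modulo I, any point will do. *)
case: (classic (exists2 p : {mpoly K[n.+1]}, p != 0 & I (mmap iota y p))); last first.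
  move=> np; exists (fun _ => 0) => p Ip; have [->|p0] := eqVneq p 0.
    by rewrite meval0.
  by case: np; exists p.
case=> p p0 Ip; pose d := (msize p).-1; pose pd := pihomog mdeg d p.
have pd0 : pd != 0.
  apply/negP => /eqP/mpolyP/(_ (mlead p)); rewrite mcoeff0 /pd pihomogE.
  rewrite raddf_sum /= big_mkcond (bigD1_seq (mlead p)) ?msupp_uniq ?mlead_supp //=.
  rewrite /d -mlead_deg //= eqxx mcoeffZ mcoeffX eqxx mulr1 big1 ?addr0.
    by apply/eqP; rewrite mleadc_eq0.
  move=> m /negbTE ml; case: ifP => // _.
  by rewrite mcoeffZ mcoeffX ml mulr0.
(* The extra variable forces c to be nonzero at [ord_max], so that t = y / c makes sense there. *)
have [c] : exists c : 'I_n.+1 -> K, (pd * 'X_ord_max).@[c] != 0.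
  apply: mpoly_nz_point; rewrite mulf_neq0 //.
  by rewrite -msize_poly_eq0 msizeX.
rewrite mevalM mevalXU mulf_eq0 negb_or => /andP[pdc cn].
pose cc : {rmorphism K -> {poly {mpoly K[n]}}} := @polyC {mpoly K[n]} \o @mpolyC n K.
(* The substitution y i = y' i + c i t, with t as the polynomial variable; [E] evaluates at the
   actual y' and t. *)
pose h i : {poly {mpoly K[n]}} :=
  (if unlift ord_max i is Some j then ('X_j)%:P else 0) + cc (c i) * 'X.
pose t := iota (c ord_max)^-1 * y ord_max.
pose y' j := y (lift ord_max j) - iota (c (lift ord_max j)) * t.
pose M' : {rmorphism {mpoly K[n]} -> A} := mmap iota y'.
pose E : {rmorphism {poly {mpoly K[n]}} -> A} := horner_eval t \o map_poly M'.
have Epsi q : E (mmap cc h q) = mmap iota y q.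
  rewrite rmorph_mmap; apply: eq_mmap => [a|i] /=.
    by rewrite /horner_eval map_polyC hornerC /= mmapC.
  rewrite /horner_eval /h rmorphD rmorphM /= map_polyX map_polyC hornerD hornerMX.
  rewrite hornerC /= mmapC; case: unliftP => [j ->|->].
    by rewrite map_polyC hornerC /= mmapX mmap1U /y' subrK.
  by rewrite raddf0 hornerC add0r /t mulrA -rmorphM divff // rmorph1 mul1r.
have [b bP] := IH y'.
(* The relations between t and the y', specialized at the point b. If this ideal is proper, a common
   root gives the missing coordinate. *)
pose J (f : {poly K}) := exists2 g, I (E g) & f = map_poly (meval b) g.
have idJ : is_ideal J.
  split.
  - by exists 0; rewrite ?rmorph0 //; apply: is_ideal0.
  - move=> _ _ [f If ->] [g Ig ->]; exists (f + g); rewrite ?rmorphD //.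
    exact: is_idealD.
  - move=> q _ [f If ->]; exists (map_poly (@mpolyC n K) q * f).
      by rewrite rmorphM; apply: is_idealMl.
    rewrite rmorphM /=; congr (_ * _); apply/polyP => i.
    by rewrite !coef_map /= mevalC.
(* In t, the relation p has degree d and a nonzero constant as top coefficient: t is integral over
   the y' modulo I. *)
have qd : (size (mmap cc h p) <= d.+1)%N /\ (mmap cc h p)`_d = (pd.@[c])%:MP.
  have sh i : (size (h i) <= 2)%N.
    apply: leq_trans (size_polyD _ _) _; rewrite geq_max; apply/andP; split.
      by case: unlift => [j|]; rewrite ?size_poly0 // (leq_trans (size_polyC_leq1 _)).
    by apply: leq_trans (size_polyMleq _ _) _; rewrite size_polyX addn2 ltnS size_polyC_leq1.
  have h1 i : (h i)`_1 = (c i)%:MP.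
    rewrite coefD coefMX coefC /=; case: unlift => [j|].
      by rewrite coefC add0r.
    by rewrite coef0 add0r.
  have mh m : (size (mmap1 h m) <= (mdeg m).+1)%N /\
      (mmap1 h m)`_(mdeg m) = (\prod_i c i ^+ m i)%:MP.
    have [s1 s2] := coef_prod_linear (index_enum 'I_n.+1) m sh.
    rewrite mdegE; split=> //; rewrite s2 rmorph_prod; apply: eq_bigr => i _.
    by rewrite h1 rmorphXn.
  have md m : m \in msupp p -> (mdeg m <= d)%N.
    by move=> /msize_mdeg_lt; rewrite /d; case: (msize p).
  split.
    apply: leq_trans (size_sum _ _ _) _; rewrite big_seq_cond.
    elim/big_ind: _ => // [g1 g2 sa sb|m /andP[/md mp _]]; first by rewrite geq_max sa.
    rewrite /cc /= mul_polyC; apply: leq_trans (size_scale_leq _ _) _.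
    by apply: leq_trans (proj1 (mh m)) _; rewrite ltnS.
  have -> : pd.@[c] = \sum_(m <- msupp p | mdeg m == d) p@_m * \prod_i c i ^+ m i.
    rewrite /pd pihomogE rmorph_sum /=; apply: eq_bigr => m _.
    by rewrite mevalZ mevalX.
  rewrite /mmap coef_sum raddf_sum [RHS]big_mkcond big_seq [RHS]big_seq.
  apply: eq_bigr => m /md mp; rewrite coefCM; case: eqP => [<-|/eqP nd].
    by rewrite (proj2 (mh m)) /= mpolyCM.
  rewrite nth_default ?mulr0 //; apply: leq_trans (proj1 (mh m)) _.
  by rewrite ltn_neqAle nd.
have J1 : ~ J 1.
  case=> f If; set q := mmap cc h p in qd *.
  have Iq : I (E q) by rewrite Epsi.
  case: qd => sq qd f1; case: (posnP d) => [d0|dp].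
    move: sq qd; rewrite d0 => /size1_polyC qE q0.
    move: Iq; rewrite qE q0 /E /= /horner_eval map_polyC hornerC /= mmapC.
    by move/ideal_const/eqP; rewrite (negbTE pdc).
  have qdn0 : q`_d != 0.
    by rewrite qd mpolyC_eq0.
  have sqE : size q = d.+1.
    by apply/anti_leq; rewrite sq ltnNge; apply: contra qdn0 => /leq_sizeP ->.
  have lq : lead_coef q = (pd.@[c])%:MP by rewrite lead_coefE sqE.
  (* Eliminating t between f, which becomes 1 at b, and the integral equation q gives a relation r
     among the y' with r(b) nonzero, against the choice of b. *)
  have [] := @resultant_avoids K {mpoly K[n]} (meval b) f q.
  - by rewrite sqE.
  - by rewrite lq /= mevalC.
  - by rewrite f1.
  move=> r [u [v [e rb]]]; move/eqP: rb; apply; apply: bP.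
  have -> : mmap iota y' r = E r%:P by rewrite /E /= /horner_eval map_polyC hornerC.
  by rewrite e rmorphD !rmorphM; apply: is_idealD => //; apply: is_idealMl.
have [x xJ] := poly_ideal_root idJ J1.
exists (fun i => (if unlift ord_max i is Some j then b j else 0) + c i * x) => q Iq.
have /rootP e : root (map_poly (meval b) (mmap cc h q)) x.
  by apply: xJ; exists (mmap cc h q); rewrite ?Epsi.
pose M2 : {rmorphism {poly {mpoly K[n]}} -> K} := horner_eval x \o map_poly (meval b).
rewrite -[RHS]e -[RHS]/(M2 (mmap cc h q)) rmorph_mmap [LHS]meval_mmap; apply: eq_mmap => [a|i] /=.
  by rewrite /horner_eval map_polyC hornerC /= mevalC.
rewrite /horner_eval /h rmorphD rmorphM /= map_polyX map_polyC hornerD hornerMX.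
rewrite hornerC /= mevalC; case: unlift => [j|].
  by rewrite map_polyC hornerC /= mevalXU.
by rewrite raddf0 hornerC.
Qed.
End WeakNullstellensatz.

(** Rabinowitsch's trick: with a new variable T, a common zero of I and 1 - f T would be a zero of I
    at which f does not vanish. So these generate the unit ideal, and an expression of 1 yields the
    power of f. *)
Lemma nullstellensatz (K : closedFieldType) (N : nat) (I : {mpoly K[N]} -> Prop) f :
    is_ideal I ->
    (forall c, (forall p, I p -> p.@[c] = 0) -> f.@[c] = 0) ->
  exists M, I (f ^+ M).
Proof.
move=> idI fV.
pose A := {poly {mpoly K[N]}}.
pose iota : {rmorphism K -> A} := @polyC {mpoly K[N]} \o @mpolyC N K.
pose u : A := 1 - f%:P * 'X.
pose J (P : A) := exists p r : A, (forall i, I p`_i) /\ P = p + r * u.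
have idJ : is_ideal J.
  split.
  - by exists 0, 0; split=> [i|]; rewrite ?coef0 ?mul0r ?addr0 //; apply: is_ideal0.
  - move=> _ _ [p [r [Ip ->]]] [q [s [Iq ->]]]; exists (p + q), (r + s).
    by split=> [i|]; [rewrite coefD; apply: is_idealD|ring].
  - move=> a _ [p [r [Ip ->]]]; exists (a * p), (a * r); split=> [i|]; last by ring.
    by rewrite coefM; apply: ideal_sum => // j _ _; apply: is_idealMl.
case: (classic (J 1)) => [[p [r [Ip e]]]|J1].
  (* Comparing coefficients in 1 = p + r (1 - f T), the i-th one of r is f^i
     modulo I. *)
  have rf i : I (f ^+ i - r`_i).
    elim: i => [|i IH].
      have := congr1 (fun q : A => q`_0) e.
      rewrite coefD coef0M coefB !coef1 coefMX /= subr0 mulr1 => e0.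
      by rewrite expr0 (e0 : 1 = _) addrK.
    have := congr1 (fun q : A => q`_i.+1) e.
    rewrite /u mulrBr mulr1 mulrA coefD coefB coefMX /= coef1 /= mulrC coefCM => e0.
    have -> : f ^+ i.+1 - r`_i.+1 = f * (f ^+ i - r`_i) + p`_i.+1.
      rewrite exprS; apply/eqP; rewrite -subr_eq0; apply/eqP.
      transitivity (- (p`_i.+1 + (r`_i.+1 - f * r`_i))); first by ring.
      by rewrite -e0 oppr0.
    by apply: is_idealD => //; apply: is_idealMl.
  exists (size r); rewrite -[f ^+ _]subr0 -(nth_default 0 (leqnn (size r))).
  exact: rf.
pose y (i : 'I_N.+1) : A := if unlift ord_max i is Some j then ('X_j)%:P else 'X.
have [c cJ] := weak_nullstellensatz iota idJ J1 y.
pose c' j := c (lift ord_max j).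
pose wd (p : {mpoly K[N]}) : {mpoly K[N.+1]} :=
  p \mPo [tuple 'X_(lift ord_max j) | j < N].
have wdE p : mmap iota y (wd p) = p%:P.
  rewrite mmap_comp_mpoly.
  transitivity (mmap iota (@polyC _ \o (fun j => 'X_j)) p).
    by apply: eq_mmap => // j; rewrite tnth_mktuple mmapX mmap1U /y liftK.
  rewrite -(rmorph_mmap (@mpolyC N K) (@polyC {mpoly K[N]})).
  by congr polyC; rewrite -[RHS]comp_mpoly_id; apply: eq_mmap => // j; rewrite tnth_mktuple.
have wdc p : (wd p).@[c] = p.@[c'].
  by rewrite comp_mpoly_meval; apply: meval_eq => j; rewrite tnth_mktuple mevalXU.
have fc : f.@[c'] = 0.
  apply: fV => p Ip; rewrite -wdc; apply: cJ; rewrite wdE.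
  exists p%:P, 0; split=> [i|]; last by rewrite mul0r addr0.
  by rewrite coefC; case: eqP => // _; apply: is_ideal0.
have : (1 - wd f * 'X_ord_max).@[c] = 0.
  apply: cJ; exists 0, 1; split=> [i|]; first by rewrite coef0; apply: is_ideal0.
  rewrite rmorphB rmorph1 rmorphM /= wdE mmapX mmap1U /y unlift_none.
  by rewrite add0r mul1r.
rewrite mevalB mevalM meval1 wdc fc mul0r subr0 => /eqP.
by rewrite oner_eq0.
Qed.

(* The exponents e_i are decreased one at a time, passing from A to the
   colon ideal (A : y_i). *)
Lemma ideal_exp_gen_sub (R : comNzRingType) (m : nat) (y : 'I_m.+1 -> R)
    (N : nat) (e : 'I_m.+1 -> nat) (A : R -> Prop) :
    is_ideal A -> (\sum_i e i <= N)%N -> (forall i, A (y i ^+ e i)) ->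
  forall x, ideal_exp (ideal_gen (fun p => exists i, p = y i)) N x -> A x.
Proof.
elim: N e A => [|N IH] e A idA eN Ay.
  have e0 : e ord0 = 0%N.
    by apply/eqP; rewrite -leqn0 (leq_trans _ eN) // (bigD1 ord0) //= leq_addr.
  move=> x _; rewrite -[x]mulr1; apply: is_idealMl => //.
  by have := Ay ord0; rewrite e0 expr0.
case: (pickP (fun i => e i == 0%N)) => [i /eqP ei|en] x.
  by move=> _; rewrite -[x]mulr1; apply: is_idealMl => //; have := Ay i; rewrite ei expr0.
rewrite /ideal_exp iterS -/(ideal_exp _ N); apply: ideal_gen_sub => // {}x [z [x' [zJ xJ ->]]].
have idC (b : R) : is_ideal (fun r => A (r * b)).
  split=> [|r s Ar As|r s As]; first by rewrite mul0r; apply: is_ideal0.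
    by rewrite mulrDl; apply: is_idealD.
  by rewrite -mulrA; apply: is_idealMl.
move: zJ; apply: (ideal_gen_sub (idC x')) => _ [i ->]; rewrite mulrC.
apply: (IH (fun j => (e j - (j == i))%N) _ (idC (y i))) => // [|j].
  rewrite (bigD1 i) //= eqxx (eq_bigr e) => [|j /negbTE ->]; last by rewrite subn0.
  by move: eN; rewrite (bigD1 i) //=; move/negbT: (en i); lia.
case: eqP => [->|_]; last by rewrite subn0; apply: (is_idealMr idA).
by rewrite subn1 -exprSr prednK ?lt0n ?en.
Qed.

(** * Minors and rank *)

(** [is_minor] selects rows and columns in increasing order, while rank arguments provide merely
    injective selections; sorting only permutes the rows and columns of the minor. *)
Lemma increasing_reindex (r p : nat) (f : 'I_r -> 'I_p) : injective f ->
  exists s : 'S_r, forall i j : 'I_r, (i < j)%N -> (f (s i) < f (s j))%N.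
Proof.
move=> injf; pose le (i j : 'I_p) := (i <= j)%N.
pose t := [tuple f i | i < r].
have st : size (sort le t) == r by rewrite size_sort size_tuple.
have /tuple_permP [s /= es] : perm_eq (Tuple st) t by rewrite /= perm_sort.
have nthE (i : 'I_r) : nth (f i) (sort le t) i = f (s i).
  by rewrite es nth_mktuple tnth_mktuple.
have ut : uniq (map val (sort le t)).
  rewrite (map_inj_uniq val_inj) sort_uniq /= map_inj_uniq ?enum_uniq //.
have so : sorted ltn (map val (sort le t)).
  rewrite ltn_sorted_uniq_leq ut /= sorted_map.
  by apply: sort_sorted => i j; apply: leq_total.
exists s => i j ij.
have sj (l : 'I_r) : (l < size (sort le t))%N by rewrite (eqP st).
have := sorted_ltn_nth ltn_trans 0%N so.
move=> /(_ i j); rewrite !inE !size_map !sj => /(_ isT isT ij).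
by rewrite (nth_map (f i)) // (nth_map (f j)) // !nthE.
Qed.

Section Minors.
Variables (K : fieldType) (p q r : nat) (M : 'M[K]_(p, q)).

(** The submatrix is a product with M as one factor, so its rank is at most that of M. *)
Lemma mxsub_det0 (f : 'I_r -> 'I_p) (g : 'I_r -> 'I_q) :
  (\rank M < r)%N -> \det (mxsub f g M) = 0.
Proof.
move=> rM; apply/eqP/negPn/negP => d0.
have uS : mxsub f g M \in unitmx by rewrite unitmxE unitfE.
move: rM; rewrite ltnNge => /negP; apply.
rewrite -{1}(mxrank_unit uS).
have -> : mxsub f g M = rowsub f 1%:M *m M *m colsub g 1%:M.
  apply/matrixP => i j; rewrite !mxE (bigD1 (g j)) //= !mxE eqxx mulr1.
  rewrite (bigD1 (f i)) //= !mxE eqxx mul1r !big1 ?addr0 // => l nl.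
    by rewrite !mxE (negbTE nl) mulr0.
  by rewrite !mxE eq_sym (negbTE nl) mul0r.
by apply: leq_trans (mxrankM_maxl _ _) (mxrankM_maxr _ _).
Qed.

Lemma rank_lt_minors :
    (forall (f : 'I_r -> 'I_p) (g : 'I_r -> 'I_q),
       (forall i j : 'I_r, (i < j)%N -> (f i < f j)%N) ->
       (forall i j : 'I_r, (i < j)%N -> (g i < g j)%N) ->
       \det (mxsub f g M) = 0) ->
  (\rank M < r)%N.
Proof.
move=> minors0; rewrite ltnNge; apply/negP => rM.
pose f0 (i : 'I_r) := maxrankfun M (widen_ord rM i).
have inj0 : injective f0.
  by move=> i j /maxrankfun_inj /(congr1 val) /= ij; apply: val_inj.
have free0 : row_free (rowsub f0 M).
  have -> : rowsub f0 M = rowsub (widen_ord rM) (rowsub (maxrankfun M) M).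
    by apply/matrixP => i j; rewrite !mxE.
  rewrite -row_leq_rank rowsubE mxrankMfree ?maxrowsub_free //.
  have -> : rowsub (widen_ord rM) 1%:M = pid_mx r :> 'M[K]_(r, \rank M).
    by apply/matrixP => i j; rewrite !mxE -val_eqE /= ltn_ord andbT.
  rewrite row_leq_rank; apply/row_freeP; exists (pid_mx r).
  by rewrite mul_pid_mx minnn (minn_idPr rM) pid_mx_1.
(* Once r independent rows are chosen, the transpose has full rank, and r of its rows give the
   columns. *)
pose N := (rowsub f0 M)^T.
have fullN : row_full N by rewrite -row_leq_rank in free0; rewrite /row_full mxrank_tr eqn_leq rank_leq_row.
pose g0 := fullrankfun fullN.
have unitN : mxsub f0 g0 M \in unitmx.
  rewrite -unitmx_tr.
  have -> : (mxsub f0 g0 M)^T = rowsub g0 N by apply/matrixP => i j; rewrite !mxE.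
  exact: fullrowsub_unit.
have [s incs] := increasing_reindex inj0.
have [t inct] := increasing_reindex (@fullrankfun_inj _ _ _ _ fullN).
have := minors0 (f0 \o s) (g0 \o t) incs inct.
have -> : mxsub (f0 \o s) (g0 \o t) M = row_perm s (col_perm t (mxsub f0 g0 M)).
  by apply/matrixP => i j; rewrite !mxE.
apply/eqP; rewrite -unitfE -unitmxE row_permE col_permE !unitmx_mul !unitmx_perm.
by rewrite unitN.
Qed.
End Minors.

(** * Pencils of lines *)

Section Pencils.
Variables (K : closedFieldType) (n : nat) (a : 'M[K]_(3, n.+1)).

(* Multiplication by the form x of degree k, from degree n - k to degree n. *)
Definition mult_mx (k : nat) (x : 'rV[K]_k.+1) : 'M[K]_((n - k).+1, n.+1) :=
  \matrix_(i, j) if (i <= j <= i + k)%N then x 0 (inord (j - i)) else 0.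

(** The columns [moment t] and [moment_infty] are the evaluations of forms of degree n at (1:t) and
    (0:1); multiplied by [a] on the left, they give the points of C with these parameters. *)
Definition moment (t : K) : 'cV[K]_n.+1 := \col_j t ^+ j.
Definition moment_infty : 'cV[K]_n.+1 := delta_mx ord_max 0.

Definition pullback (l : 'rV[K]_3) : {poly K} := rVpoly (l *m a).

(* The lines l through v pull back to multiples of g, seen as a form of degree
   k: the size bound on the cofactor keeps track of the point at infinity. *)
Definition common_factor (k : nat) (v : 'rV[K]_3) (g : {poly K}) : Prop :=
  [/\ g != 0, (size g <= k.+1)%N &
      forall l : 'rV[K]_3, l *m v^T = 0 ->
        exists2 c : {poly K}, (size c <= (n - k).+1)%N & pullback l = c * g].

Definition has_factor (k : nat) (v : 'rV[K]_3) : Prop := exists g, common_factor k v g.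

Lemma rVpoly_mult_mx k (x : 'rV[K]_k.+1) c : (k <= n)%N ->
  rVpoly (c *m mult_mx x) = rVpoly c * rVpoly x.
Proof.
move=> kn; rewrite mulmx_sum_row [in RHS](row_sum_delta c) !linear_sum /= mulr_suml.
apply: eq_bigr => i _; rewrite !linearZ /= -scalerAl; congr (_ *: _).
rewrite rVpoly_delta; apply/polyP => j; rewrite coefXnM !coef_rVpoly.
have ik : (i + k <= n)%N by have := ltn_ord i; lia.
case: insubP => [j' _ jE|]; rewrite ?mxE ?jE.
  case: (ltnP j i) => ij /=; first by [].
  case: insubP => [l lk lE|lk]; rewrite -leq_subLR -ltnS ?lk ?(negbTE lk) //.
  by congr (x _ _); apply: val_inj; rewrite /= inordK // lE.
rewrite -leqNgt => nj; case: ltnP => // ij.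
by rewrite insubF //; apply/negP; lia.
Qed.

Lemma moment_eval (w : 'rV[K]_n.+1) t : w *m moment t = (rVpoly w).[t]%:M.
Proof.
apply/matrixP => i j; rewrite !ord1 !mxE eqxx mulr1n horner_poly.
by apply: eq_bigr => l _; rewrite mxE valK.
Qed.

Lemma moment_infty_eval (w : 'rV[K]_n.+1) : w *m moment_infty = ((rVpoly w)`_n)%:M.
Proof.
rewrite -colE; apply/matrixP => i j; rewrite !ord1 !mxE eqxx mulr1n.
by rewrite -[X in _`_X]/(val (@ord_max n)) coef_rVpoly_ord.
Qed.

Lemma rVpoly_inj d : injective (@rVpoly K d).
Proof. exact: can_inj rVpolyK. Qed.

Lemma size_rVpoly d (w : 'rV[K]_d) : (size (rVpoly w) <= d)%N.
Proof. exact: size_poly. Qed.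

Lemma rVpoly_eq0 d (w : 'rV[K]_d) : (rVpoly w == 0) = (w == 0).
Proof. by rewrite -(raddf0 (@rVpoly K d)) (inj_eq (@rVpoly_inj d)). Qed.

Lemma mult_mx_free k (x : 'rV[K]_k.+1) : (k <= n)%N -> x != 0 -> row_free (mult_mx x).
Proof.
move=> kn x0; apply/inj_row_free => c /(congr1 (@rVpoly _ _)).
rewrite rVpoly_mult_mx // raddf0 => /eqP.
by rewrite mulf_eq0 !rVpoly_eq0 (negbTE x0) orbF => /eqP.
Qed.

Lemma mult_mx_sub k (x : 'rV[K]_k.+1) (w : 'rV[K]_n.+1) : (k <= n)%N ->
  (w <= mult_mx x)%MS <->
  exists2 c : {poly K}, (size c <= (n - k).+1)%N & rVpoly w = c * rVpoly x.
Proof.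
move=> kn; split=> [/submxP[c ->]|[c sc e]].
  by exists (rVpoly c); rewrite ?size_rVpoly // rVpoly_mult_mx.
apply/submxP; exists (poly_rV c); apply: rVpoly_inj.
by rewrite rVpoly_mult_mx // poly_rV_K.
Qed.

(** The line of v is the orthogonal of its own orthogonal. *)
Lemma perp_scalar (v : 'rV[K]_3) (w : 'cV[K]_3) : v != 0 ->
  (forall l : 'rV[K]_3, l *m v^T = 0 -> l *m w = 0) -> exists c, w = c *: v^T.
Proof.
move=> v0 h; suff /sub_rVP[c e] : (w^T <= v)%MS.
  by exists c; rewrite -[w]trmxK e linearZ.
rewrite submxE; apply/eqP/trmx_inj; rewrite trmx_mul trmxK trmx0.
apply/row_matrixP => i; rewrite row_mul row0; apply: h.
by rewrite -row_mul -trmx_mul mulmx_coker trmx0 row0.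
Qed.

(** The linear forms vanishing at v make up a space of dimension 2, and their pullbacks lie in the
    row space of [mult_mx x]: this gives two independent relations between the n - k + 4 rows. *)
Lemma has_factor_rank k (v : 'rV[K]_3) (x : 'rV[K]_k.+1) :
    (k <= n)%N -> v != 0 -> common_factor k v (rVpoly x) ->
  (\rank (col_mx (mult_mx x) a) < n - k + 3)%N.
Proof.
move=> kn v0 [x0 _ xl]; pose L := kermx v^T.
have rL : \rank L = 2 by rewrite mxrank_ker mxrank_tr rank_rV v0.
have : (L *m a <= mult_mx x)%MS.
  apply/row_subP => i; rewrite row_mul; apply/mult_mx_sub => //; apply: xl.
  by rewrite -row_mul mulmx_ker row0.
case/submxP=> C e.
have : row_mx (- C) L *m col_mx (mult_mx x) a = 0.
  by rewrite mul_row_col mulNmx e addNr.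
move/mulmx0_rank_max.
have : (\rank L <= \rank (row_mx (- C) L))%N.
  have eL : L = row_mx (- C) L *m col_mx 0 1%:M.
    by rewrite mul_row_col mulmx0 mulmx1 add0r.
  rewrite {1}eL; exact: mxrankM_maxl.
by rewrite rL; lia.
Qed.

Hypothesis base_free : forall t, a *m moment t != 0.
Hypothesis base_free_infty : a *m moment_infty != 0.

(** Evaluation at a zero of the form x kills all its multiples, and the f_u have no common zero. If
    [rVpoly x] is constant, the form is a multiple of s^k with k > 0 and the zero is at infinity. *)
Lemma mult_mx_kills k (x : 'rV[K]_k.+1) : (0 < k <= n)%N -> x != 0 ->
  exists2 z : 'cV[K]_n.+1, mult_mx x *m z = 0 & a *m z != 0.
Proof.
case/andP=> k0 kn x0.
have rv0 z : (forall i, row i (mult_mx x) *m z = 0) -> mult_mx x *m z = 0.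
  by move=> h; apply/row_matrixP => i; rewrite row_mul h row0.
have rowE i : exists c, rVpoly (row i (mult_mx x)) = c * rVpoly x /\ (size c <= (n - k).+1)%N.
  by have [c sc e] := proj1 (mult_mx_sub x _ kn) (row_sub i (mult_mx x)); exists c.
case: (eqVneq (size (rVpoly x)) 1%N) => [s1|/closed_rootP[t /rootP xt]]; last first.
  exists (moment t) => //; apply: rv0 => i; rewrite moment_eval.
  by have [c [-> _]] := rowE i; rewrite hornerM xt mulr0 raddf0.
exists moment_infty => //; apply: rv0 => i; rewrite moment_infty_eval.
have [c [-> sc]] := rowE i; rewrite nth_default ?raddf0 //.
by apply: leq_trans (size_polyMleq _ _) _; rewrite s1 addn1 (leq_trans sc) //; lia.
Qed.

(** The rows of [mult_mx x] being independent, a relation between the rows of the whole matrix is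
    determined by its last three entries. These entries sweep out a space U of linear forms whose
    pullbacks are multiples of x; U has dimension 2 and v spans its orthogonal. A z killed by the
    multiples of x is sent by [a] into the orthogonal of U. *)
Lemma rank_has_factor k (x : 'rV[K]_k.+1) :
    (0 < k <= n)%N -> x != 0 -> (\rank (col_mx (mult_mx x) a) < n - k + 3)%N ->
  exists2 v : 'rV[K]_3, v != 0 & common_factor k v (rVpoly x) /\
    forall z : 'cV[K]_n.+1, mult_mx x *m z = 0 -> exists c, a *m z = c *: v^T.
Proof.
move=> /[dup] k1n /andP[k0 kn] x0; set T := mult_mx x => rM.
have fT : row_free T by apply: mult_mx_free.
pose M := kermx (col_mx T a); pose U := rsubmx M; pose C := lsubmx M.
have e : C *m T + U *m a = 0 by rewrite -mul_row_col hsubmxK mulmx_ker.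
have {}e : U *m a = - C *m T by apply/eqP; rewrite mulNmx -addr_eq0 addrC e.
have rU : (2 <= \rank U)%N.
  have : (\rank M <= \rank U)%N.
    have -> : M = U *m row_mx (- (a *m pinvmx T)) 1%:M.
      rewrite mul_mx_row mulmx1 mulmxN mulmxA e !mulNmx opprK mulmxKp //.
      by rewrite hsubmxK.
    exact: mxrankM_maxl.
  by apply: leq_trans; rewrite mxrank_ker; lia.
have rU2 : (\rank U <= 2)%N.
  rewrite leqNgt; apply/negP => U3.
  (* In rank 3 every f_u would be a multiple of x, and the f_u would have a common zero. *)
  have /row_fullP[W WU] : row_full U by rewrite /row_full eqn_leq rank_leq_col.
  have [z] := mult_mx_kills k1n x0; rewrite -/T => Tz.
  by rewrite -[a]mul1mx -WU -(mulmxA W) e mulmxA -(mulmxA _ T z) Tz mulmx0 eqxx.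
have rU' : \rank U = 2 by apply/anti_leq; rewrite rU2.
pose V := kermx U^T.
have rV : \rank V = 1%N by rewrite mxrank_ker mxrank_tr rU'.
pose v := nz_row V.
have v0 : v != 0 by rewrite nz_row_eq0 -mxrank_eq0 rV.
have vU : v *m U^T = 0 by apply/sub_kermxP; apply: nz_row_sub.
have Uv : U *m v^T = 0 by apply: trmx_inj; rewrite trmx_mul trmxK trmx0.
have sub l : l *m v^T = 0 -> (l <= U)%MS.
  move/sub_kermxP => lv; apply: submx_trans lv _.
  have sU : (U <= kermx v^T)%MS by apply/sub_kermxP.
  rewrite -(geq_leqif (mxrank_leqif_sup sU)) mxrank_ker mxrank_tr rank_rV v0.
  by rewrite rU'.
exists v => //; split.
  split; rewrite ?rVpoly_eq0 ?size_rVpoly // => l /sub/submxP[w ->].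
  by apply/mult_mx_sub => //; rewrite -mulmxA e mulNmx mulmxN -mulNmx mulmxA submxMl.
rewrite -/T => z Tz; apply: perp_scalar => // l /sub/submxP[w ->].
by rewrite mulmxA -(mulmxA w) e mulmxA -(mulmxA _ T z) Tz mulmx0.
Qed.
End Pencils.

(** * Elimination ideals *)

(** Polynomials respect congruences modulo I. This serves to replace w_u by its expression in the
    z_j, and to work modulo a linear form. *)
Lemma ideal_comp_mpoly (R S : comNzRingType) (m : nat) (f : {rmorphism R -> S})
    (I : S -> Prop) (y y' : 'I_m -> S) (p : {mpoly R[m]}) :
  is_ideal I -> (forall i, I (y i - y' i)) -> I (mmap f y p - mmap f y' p).
Proof.
move=> idI Iy.
have IM b b' c c' : I (b - b') -> I (c - c') -> I (b * c - b' * c').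
  move=> Ib Ic; have -> : b * c - b' * c' = c * (b - b') + b' * (c - c') by ring.
  by apply: is_idealD => //; apply: is_idealMl.
have I0 b : I (b - b) by rewrite subrr; apply: is_ideal0.
rewrite /mmap -sumrB; apply: ideal_sum => // e _ _; apply: (IM) => //.
apply: (big_ind2 (fun b b' => I (b - b'))) => // i _.
by elim: (e i) => [|d IH]; rewrite ?expr0 // !exprS; apply: (IM).
Qed.

Lemma mem_ideal_exp (R : comNzRingType) (J : R -> Prop) x m :
  J x -> ideal_exp J m (x ^+ m).
Proof.
move=> Jx; elim: m => [|m IH] //.
by apply: mem_ideal_gen; exists x, (x ^+ m); split; rewrite ?exprS.
Qed.

Lemma meval_sum (R : comNzRingType) m (v : 'I_m -> R) (T : Type) (r : seq T)
    (P : pred T) (F : T -> {mpoly R[m]}) :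
  (\sum_(i <- r | P i) F i).@[v] = \sum_(i <- r | P i) (F i).@[v].
Proof. exact: (raddf_sum (meval v)). Qed.

Lemma meval_lvars (K : fieldType) l m (p : {mpoly K[l]}) (x : 'rV_l) (y : 'rV_m) :
  (lvars m p).@[row_mx x y 0] = p.@[x 0].
Proof.
rewrite comp_mpoly_meval; apply: meval_eq => i.
by rewrite tnth_mktuple mevalXU row_mxEl.
Qed.

Lemma meval_rvars (K : fieldType) l m (p : {mpoly K[m]}) (x : 'rV_l) (y : 'rV_m) :
  (rvars l p).@[row_mx x y 0] = p.@[y 0].
Proof.
rewrite comp_mpoly_meval; apply: meval_eq => i.
by rewrite tnth_mktuple mevalXU row_mxEr.
Qed.

Section Elimination.
Variables (K : closedFieldType) (n : nat) (a : 'M[K]_(3, n.+1)).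
Hypothesis base_free : forall t, a *m moment n t != 0.
Hypothesis base_free_infty : a *m moment_infty K n != 0.
Variable k : nat.
Hypothesis k_bounds : (0 < k <= n)%N.
Let kn : (k <= n)%N. Proof. by case/andP: k_bounds. Qed.

Lemma map_Mmat (x : 'rV[K]_k.+1) :
  map_mx (meval (x 0)) (Mmat a k) = col_mx (mult_mx n x) a.
Proof.
rewrite map_col_mx; congr col_mx; apply/matrixP => i j; rewrite !mxE ?mevalC //.
by case: ifP => _; rewrite ?mevalXU ?meval0.
Qed.

Lemma ideal_X_vanish (x : 'rV[K]_k.+1) :
  (forall p, ideal_X a p -> p.@[x 0] = 0) <->
  (\rank (col_mx (mult_mx n x) a) < n - k + 3)%N.
Proof.
split=> [h|rM p].
  apply: rank_lt_minors => f g incf incg; rewrite -map_Mmat -map_mxsub det_map_mx.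
  by apply: h; apply: mem_ideal_gen; exists f, g.
apply: (@ideal_gen_sub _ _ (fun p => p.@[x 0] = 0)) => [|_ [f [g [_ _ ->]]]].
  split=> [|q r q0 r0|q r r0]; first by rewrite meval0.
    by rewrite mevalD q0 r0 addr0.
  by rewrite mevalM r0 mulr0.
by rewrite -det_map_mx map_mxsub map_Mmat mxsub_det0.
Qed.

(** The substitution l = i + j turns the sum into a row of [mult_mx]; [inord] is exact because i + j
    <= k + (n - k). *)
Lemma meval_shift (x : 'rV[K]_k.+1) (z : 'rV[K]_n.+1) (j : nat)
    (jn : (j < (n - k).+1)%N) :
  (\sum_(i < k.+1) 'X_(lshift n.+1 i) * 'X_(rshift k.+1 (inord (i + j)))).@[row_mx x z 0]
   = (mult_mx n x *m z^T) (Ordinal jn) 0.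
Proof.
rewrite meval_sum mxE.
under eq_bigr do rewrite mevalM !mevalXU row_mxEl row_mxEr.
under [RHS]eq_bigr do rewrite !mxE /=.
have ink (i : 'I_k.+1) : (i + j < n.+1)%N by have := ltn_ord i; lia.
pose h (i : 'I_k.+1) : 'I_n.+1 := Ordinal (ink i).
rewrite [RHS](bigID (fun l : 'I_n.+1 => (j <= l <= j + k)%N)) /= [X in _ = _ + X]big1 ?addr0; last first.
  by move=> l /negbTE ->; rewrite mul0r.
rewrite (reindex_omap h (fun l : 'I_n.+1 => Some (inord (l - j)))) /=; last first.
  move=> l /andP[jl lk]; congr Some; apply: val_inj => /=.
  by rewrite inordK; lia.
apply: esym; apply: congr_big => // [i|i _].
  have ik := ltn_ord i; rewrite addnK inord_val eqxx andbT; lia.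
have -> : (j <= i + j <= j + k)%N by have := ltn_ord i; lia.
rewrite addnK inord_val; congr (_ * z _ _); apply: val_inj => /=.
by rewrite inordK.
Qed.

(** At a point with x_i nonzero, the power of x_i brought in by the saturation can be cancelled. *)
Lemma ideal_L_vanish (x : 'rV[K]_k.+1) (z : 'rV[K]_n.+1) q :
    x != 0 -> (\rank (col_mx (mult_mx n x) a) < n - k + 3)%N ->
    mult_mx n x *m z^T = 0 -> ideal_L a k q -> q.@[z 0] = 0.
Proof.
move=> x0 rM Tz [m qm].
have /rV0Pn[i xi] := x0.
have /qm : ideal_exp (ideal_gen (fun p : {mpoly K[k.+1 + n.+1]} =>
    exists i : 'I_k.+1, p = 'X_(lshift n.+1 i))) m ('X_(lshift n.+1 i) ^+ m).
  by apply: mem_ideal_exp; apply: mem_ideal_gen; exists i.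
move/(@ideal_gen_sub _ _ (fun p => p.@[row_mx x z 0] = 0)) => h.
have : (rvars k.+1 q * 'X_(lshift n.+1 i) ^+ m).@[row_mx x z 0] = 0.
  apply: h => [|_ [[r [M rM'] ->]|[j jn ->]]].
  - split=> [|r s r0 s0|r s s0]; first by rewrite meval0.
      by rewrite mevalD r0 s0 addr0.
    by rewrite mevalM s0 mulr0.
  - rewrite meval_lvars; have := proj2 (ideal_X_vanish x) rM _ rM'.
    by rewrite rmorphXn /= => /eqP; rewrite expf_eq0 => /andP[_ /eqP].
  - have jn' : (j < (n - k).+1)%N by [].
    by rewrite (meval_shift x z jn') Tz mxE.
rewrite mevalM meval_rvars rmorphXn /= mevalXU row_mxEl => /eqP.
by rewrite mulf_eq0 expf_eq0 (negbTE xi) andbF orbF => /eqP.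
Qed.

Lemma ideal_zw_vanish (z : 'rV[K]_n.+1) p :
    (forall q, ideal_L a k q -> q.@[z 0] = 0) ->
    ideal_zw a k (rvars n.+1 p) -> p.@[(z *m a^T) 0] = 0.
Proof.
move=> Lz zw; rewrite -(meval_rvars p z).
move: zw; apply: (@ideal_gen_sub _ _ (fun p => p.@[row_mx z _ 0] = 0)) => [|_ [[r rL ->]|[u ->]]].
- split=> [|r s r0 s0|r s s0]; first by rewrite meval0.
    by rewrite mevalD r0 s0 addr0.
  by rewrite mevalM s0 mulr0.
- by rewrite meval_lvars Lz.
rewrite mevalB mevalXU row_mxEr mxE meval_sum; apply/eqP; rewrite subr_eq0; apply/eqP.
by apply: eq_bigr => j _; rewrite mevalZ mevalXU row_mxEl mxE mulrC.
Qed.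

(** All multiples of v are tested, c = 0 included, because p need not be homogeneous. *)
Definition vanishes_on_cone (p : {mpoly K[3]}) : Prop :=
  forall v, v != 0 -> has_factor a k v -> forall c, p.@[(c *: v) 0] = 0.

(** A common factor g of degree k is a point x of Z_k, and a zero of g gives z in the linear space
    of x whose image is a nonzero multiple of v. Rescaling z reaches every multiple of v, and the
    successive ideals vanish there. *)
Lemma elim_vanish p :
  radical (fun p => ideal_zw a k (rvars n.+1 p)) p -> vanishes_on_cone p.
Proof.
case=> m pm v v0 [g gv] c; have [gn0 sg gl] := gv.
pose x : 'rV[K]_k.+1 := poly_rV g.
have xg : rVpoly x = g by rewrite poly_rV_K.
have x0 : x != 0 by rewrite -rVpoly_eq0 xg.
have rM : (\rank (col_mx (mult_mx n x) a) < n - k + 3)%N.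
  by apply: (has_factor_rank kn v0); rewrite xg.
have [z Tz az] := mult_mx_kills base_free base_free_infty k_bounds x0.
have [d azv] : exists d, a *m z = d *: v^T.
  apply: perp_scalar => // l /gl[r sr e].
  have /submxP[w we] : (l *m a <= mult_mx n x)%MS.
    by apply/mult_mx_sub => //; exists r; rewrite // xg.
  by rewrite mulmxA we -mulmxA Tz mulmx0.
have d0 : d != 0 by apply: contraNneq az => d0; rewrite azv d0 scale0r.
pose y := (c / d) *: z^T.
have ya : y *m a^T = c *: v.
  by rewrite -scalemxAl -trmx_mul azv linearZ /= trmxK scalerA divfK.
have : (p ^+ m).@[(y *m a^T) 0] = 0.
  apply: ideal_zw_vanish pm => q; apply: ideal_L_vanish x0 rM _.
  by rewrite linearZ /= trmxK -scalemxAr Tz scaler0.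
by rewrite ya rmorphXn /= => /eqP; rewrite expf_eq0 => /andP[_ /eqP].
Qed.

(** Let q be p composed with the linear map z -> a z. Each x_i q vanishes on the zeros of
    [ideal_xz], so the Nullstellensatz puts a power of it in that ideal. Hence a power of q is in
    [ideal_L], and it is congruent to the same power of p modulo the equations of the w_u. *)
Lemma vanish_elim p :
  vanishes_on_cone p -> radical (fun p => ideal_zw a k (rvars n.+1 p)) p.
Proof.
move=> pv.
pose lin m0 (y : 'I_n.+1 -> {mpoly K[m0]}) := [tuple \sum_j a u j *: y j | u < 3].
pose q := p \mPo lin n.+1 (fun j => 'X_j).
have qE (z : 'rV[K]_n.+1) : q.@[z 0] = p.@[(z *m a^T) 0].
  rewrite comp_mpoly_meval; apply: meval_eq => u.
  rewrite tnth_mktuple meval_sum mxE; apply: eq_bigr => j _.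
  by rewrite mevalZ mevalXU mxE mulrC.
have idxz : is_ideal (@ideal_xz K n a k) by apply: ideal_gen_ideal.
have /fin_all_exists[M MP] (i : 'I_k.+1) : exists M,
    ideal_xz a (('X_(lshift n.+1 i) * rvars k.+1 q) ^+ M).
  apply: nullstellensatz => // c cV.
  pose x : 'rV[K]_k.+1 := \row_i c (lshift n.+1 i).
  pose z : 'rV[K]_n.+1 := \row_i c (rshift k.+1 i).
  have cE r : r.@[c] = r.@[row_mx x z 0].
    apply: meval_eq => j; rewrite mxE; case: splitP => l e; rewrite mxE; congr c; exact: val_inj.
  rewrite cE mevalM mevalXU row_mxEl meval_rvars.
  (* The factor x_i disposes of x = 0, where the incidence equations do not constrain z. *)
  have [x0|x0] := eqVneq x 0; first by rewrite x0 mxE mul0r.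
  have rM : (\rank (col_mx (mult_mx n x) a) < n - k + 3)%N.
    apply/ideal_X_vanish => r Xr; rewrite -(meval_lvars r x z) -cE; apply: cV.
    by apply: mem_ideal_gen; left; exists r => //; exists 1%N.
  have Tz : mult_mx n x *m z^T = 0.
    apply/matrixP => j i'; rewrite ord1 [RHS]mxE.
    have -> : j = Ordinal (ltn_ord j) by apply: val_inj.
    rewrite -meval_shift -cE; apply: cV.
    by apply: mem_ideal_gen; right; exists j; rewrite // -ltnS.
  have [v v0 [gv zv]] := rank_has_factor base_free base_free_infty k_bounds x0 rM.
  have [d azv] := zv _ Tz.
  rewrite qE -[z *m a^T]trmxK trmx_mul trmxK azv linearZ /= trmxK.
  by rewrite (pv v v0) ?mulr0 //; exists (rVpoly x).
pose e := \max_i M i.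
have Lq : ideal_L a k (q ^+ e).
  (* A monomial of degree (k + 1) e in the k + 1 variables x_i is divisible by some x_i^e. *)
  exists (\sum_(i < k.+1) e)%N => r.
  have idC : is_ideal (fun r => ideal_xz a (rvars k.+1 (q ^+ e) * r)).
    split=> [|s t Is It|s t It]; first by rewrite mulr0; apply: is_ideal0.
      by rewrite mulrDr; apply: is_idealD.
    by rewrite mulrCA; apply: is_idealMl.
  apply: (ideal_exp_gen_sub (e := fun=> e) idC (leqnn _)) => i.
  rewrite /rvars rmorphXn /= -exprMn mulrC.
  by apply: is_idealX (MP i) => //; apply: (leq_bigmax i).
exists e.
have idzw : is_ideal (@ideal_zw K n a k) by apply: ideal_gen_ideal.
have : ideal_zw a k (lvars 3 (q ^+ e)) by apply: mem_ideal_gen; left; exists (q ^+ e).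
have : ideal_zw a k (rvars n.+1 (p ^+ e) - lvars 3 (q ^+ e)).
  have -> : lvars 3 (q ^+ e) = p ^+ e \mPo lin (n.+1 + 3)%N (fun j => 'X_(lshift 3 j)).
    rewrite /lvars !rmorphXn /=; congr (_ ^+ _).
    rewrite /q /comp_mpoly (rmorph_mmap _ (mmap _ _)); apply: eq_mmap => [c|u] /=.
      by rewrite mmapC.
    rewrite !tnth_mktuple raddf_sum /=; apply: eq_bigr => j _.
    by rewrite mmapZ mmapX mmap1U tnth_mktuple mul_mpolyC.
  apply: ideal_comp_mpoly => // u; rewrite !tnth_mktuple.
  by apply: mem_ideal_gen; right; exists u.
by move=> I1 I2; have := is_idealD idzw I1 I2; rewrite subrK.
Qed.

Lemma elim_vanishP p :
  radical (fun p => ideal_zw a k (rvars n.+1 p)) p <-> vanishes_on_cone p.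
Proof. by split; [apply: elim_vanish|apply: vanish_elim]. Qed.
End Elimination.

(** * Characteristic zero *)

Section CharZero.
Variable K : closedFieldType.
Hypothesis charK : [pchar K] =i pred0.

Lemma natr_neq0 m : (m.+1%:R : K) != 0.
Proof. by have /pcharf0P -> := charK. Qed.

Lemma coprimep_no_root (p q : {poly K}) : p != 0 ->
  (forall x, root p x -> ~~ root q x) -> coprimep p q.
Proof.
move=> p0 h; rewrite /coprimep; apply/negPn/negP => /closed_rootP[x].
by rewrite root_gcd => /andP[/h/negP].
Qed.

Lemma simple_roots (p : {poly K}) : p != 0 ->
    (forall x, root p x -> ~~ root p^`() x) ->
  exists rs, [/\ uniq rs, size rs = (size p).-1 & forall x, (x \in rs) = root p x].
Proof.
move=> p0 h; have [r er] := closed_field_poly_normal p.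
have lp : lead_coef p != 0 by rewrite lead_coef_eq0.
exists r; split.
- rewrite -separable_prod_XsubC unlock; apply: coprimep_no_root => [|x].
    by rewrite -size_poly_gt0 size_prod_XsubC.
  by rewrite -(rootZ _ _ lp) -er => /h; rewrite er derivZ rootZ.
- by rewrite er size_scale // size_prod_XsubC.
- by move=> x; rewrite er rootZ // root_prod_XsubC.
Qed.

Lemma natr_inj : injective (fun m => m%:R : K).
Proof.
have le_inj m m' : (m <= m')%N -> m%:R = m'%:R :> K -> m = m'.
  move=> mm' e; apply/eqP; rewrite eqn_leq mm' -subn_eq0 /=.
  by case E: (m' - m)%N => [//|s]; have := natr_neq0 s; rewrite -E natrB // e subrr eqxx.
by move=> m m' e; case: (leqP m m') => [|/ltnW] /le_inj; [apply|move->].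
Qed.

Lemma lead_coef_deriv (p : {poly K}) : lead_coef p^`() = lead_coef p *+ (size p).-1.
Proof.
case: (leqP (size p) 1) => sp.
  by rewrite (size1_polyC sp) derivC lead_coef0 size_polyC; case: eqP.
have e : size p = (size p).-2.+2 by case: (size p) sp => [|[]].
have c : p^`()`_(size p).-2 = lead_coef p *+ (size p).-1.
  by rewrite coef_deriv lead_coefE e.
have p0 : p != 0 by rewrite -size_poly_gt0 ltnW.
suff s : size p^`() = (size p).-1 by rewrite lead_coefE s.
apply/anti_leq; rewrite -ltnS prednK ?size_poly_gt0 // lt_size_deriv //= {1}e.
rewrite ltnNge; apply/negP => /leq_sizeP/(_ _ (leqnn _)); rewrite c e /= => /eqP.
by rewrite -mulr_natr mulf_eq0 lead_coef_eq0 (negbTE p0) (negbTE (natr_neq0 _)).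
Qed.

(** In characteristic 0, comparing leading coefficients shows that every nonzero solution g has the
    degree of f. The combination of f and g that cancels the leading terms is again a solution, so
    it is 0. *)
Lemma wronskian_eq0 (f g : {poly K}) : f != 0 -> f * g^`() = f^`() * g ->
  exists c, g = c *: f.
Proof.
move=> f0 fg.
have size_eq h : h != 0 -> f * h^`() = f^`() * h -> size h = size f.
  move=> h0 /(congr1 lead_coef); rewrite !lead_coefM !lead_coef_deriv.
  rewrite mulrnAr mulrnAl -[_ *+ (size h).-1]mulr_natr -[_ *+ (size f).-1]mulr_natr.
  move/mulfI; rewrite mulf_neq0 ?lead_coef_eq0 // => /(_ isT)/natr_inj.
  by move: h0 f0; rewrite -!size_poly_gt0; case: (size h) (size f) => [|s] [|s'] //= _ _ ->.
have [->|g0] := eqVneq g 0; first by exists 0; rewrite scale0r.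
have sg := size_eq _ g0 fg.
pose c := lead_coef g / lead_coef f; exists c; apply/eqP; rewrite -subr_eq0.
apply/negPn/negP => h0.
have : size (g - c *: f) = size f.
  by apply: size_eq => //; rewrite derivB derivZ !mulrBr fg -!scalerAr (mulrC f).
apply/eqP; rewrite ltn_eqF //; have sf : (0 < size f)%N by rewrite size_poly_gt0.
rewrite -(prednK sf) ltnS; apply/leq_sizeP => j; rewrite leq_eqVlt => /orP[/eqP <-|lj].
  by rewrite coefB coefZ -lead_coefE -{1}sg -lead_coefE /c divfK ?lead_coef_eq0 ?subrr.
rewrite coefB coefZ !nth_default ?mulr0 ?subrr //; first by rewrite -(prednK sf).
by rewrite sg -(prednK sf).
Qed.

End CharZero.

(** * Restriction of a plane curve to the lines through a point *)

Lemma mpoly_unit_const (K : fieldType) m (p : {mpoly K[m]}) :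
  p \is a GRing.unit -> exists2 c, c != 0 & p = c%:MP.
Proof.
move=> /andP[/eqP e u]; exists p@_0 => //.
by apply: contraTneq u => ->; rewrite unitr0.
Qed.

Definition prime_elt (R : idomainType) (l : R) : Prop :=
  l != 0 /\ forall D E Q, D * E = Q * l ->
    (exists D', D = D' * l) \/ (exists E', E = E' * l).

(** Each prime on the left divides D or E and is cancelled from that side; this replaces unique
    factorization. *)
Lemma split_prime_factors (R : idomainType) (F D E : R) (s : seq R) :
    (forall l, l \in s -> prime_elt l) -> F * \prod_(l <- s) l = D * E ->
  exists D' E' s1 s2, [/\ F = D' * E', D = D' * \prod_(l <- s1) l,
    E = E' * \prod_(l <- s2) l & {subset s1 ++ s2 <= s}].
Proof.
elim: s D E => [|l s IH] D E sp.
  by rewrite big_nil mulr1 => ->; exists D, E, [::], [::]; rewrite big_nil !mulr1.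
rewrite big_cons => e; have [l0 lp] := sp l (mem_head _ _).
have sp' m : m \in s -> prime_elt m by move=> ms; apply: sp; rewrite inE ms orbT.
have /lp[[D' De]|[E' Ee]] : D * E = (F * \prod_(j <- s) j) * l.
  by rewrite -e; ring.
- have /(IH _ _ sp')[D2 [E2 [s1 [s2 [h1 h2 h3 h4]]]]] : F * \prod_(j <- s) j = D' * E.
    by apply: (mulIf l0); transitivity (D * E); [rewrite -e|rewrite De]; ring.
  exists D2, E2, (l :: s1), s2; split=> //; first by rewrite De h2 big_cons; ring.
  by move=> m; rewrite !inE => /orP[->//|/h4 ->]; rewrite orbT.
- have /(IH _ _ sp')[D2 [E2 [s1 [s2 [h1 h2 h3 h4]]]]] : F * \prod_(j <- s) j = D * E'.
    by apply: (mulIf l0); transitivity (D * E); [rewrite -e|rewrite Ee]; ring.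
  exists D2, E2, s1, (l :: s2); split=> //; first by rewrite Ee h3 big_cons; ring.
  move=> m; rewrite mem_cat !inE orbCA => /orP[->//|ms].
  by rewrite h4 ?orbT // mem_cat.
Qed.

(** The substitution of X_i - l for X_i changes a polynomial by a multiple of l only, and kills l.
    It is a ring morphism to a domain whose kernel is thus the ideal of l. *)
Lemma linear_prime (K : closedFieldType) m (l : {mpoly K[m]}) (i : 'I_m) :
    l != 0 ->
    l \mPo [tuple 'X_j - (j == i)%:R *: l | j < m] = 0 ->
  prime_elt l.
Proof.
move=> l0 ls; split=> // D E Q e.
pose y := [tuple 'X_j - (j == i)%:R *: l | j < m].
have key P : exists P', P - (P \mPo y) = P' * l.
  rewrite -{1}(comp_mpoly_id P).
  apply: (@ideal_comp_mpoly K {mpoly K[m]} m (@mpolyC m K)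
    (fun S => exists P', S = P' * l)) => [|j].
    split=> [|_ _ [P' ->] [Q' ->]|a _ [P' ->]]; first by exists 0; rewrite mul0r.
      by exists (P' + Q'); rewrite mulrDl.
    by exists (a * P'); rewrite mulrA.
  exists (j == i)%:R%:MP; rewrite !tnth_mktuple mul_mpolyC; ring.
have : (D \mPo y) * (E \mPo y) = 0.
  rewrite -[LHS]/(GRing.mul (mmap _ _ _) (mmap _ _ _)) -rmorphM e rmorphM /=.
  by rewrite -/(comp_mpoly y l) ls mulr0.
move/eqP; rewrite mulf_eq0 => /orP[]/eqP e0; [left|right].
  by have [D' eD] := key D; exists D'; rewrite -eD e0 subr0.
by have [E' eE] := key E; exists E'; rewrite -eE e0 subr0.
Qed.

Definition ev2 (K : comNzRingType) (x z : K) (D : {poly {poly K}}) : K :=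
  (map_poly (horner_eval x) D).[z].

Lemma ev2_const (K : closedFieldType) (D : {poly {poly K}}) :
  (forall x z, ev2 x z D = ev2 x 0 D) -> (size D <= 1)%N.
Proof.
move=> h; apply/leq_sizeP => -[//|j] _; apply/eqP/negPn/negP => Dj.
have [x _ /negP[]] := poly_nz_point [::] Dj.
have : map_poly (horner_eval x) D = (ev2 x 0 D)%:P.
  apply/eqP; rewrite -subr_eq0; apply/negPn/negP => /(poly_nz_point [::])[z _].
  by rewrite rootE hornerD hornerN hornerC -/(ev2 x z D) h subrr eqxx.
move/(congr1 (fun q : {poly K} => q`_j.+1)).
by rewrite coef_map /= coefC /= => e; apply/rootP; exact: e.
Qed.

Lemma dhomog_scale (K : comNzRingType) m d (p : {mpoly K[m]}) c (w : 'rV[K]_m) :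
  p \is d.-homog -> p.@[(c *: w) 0] = c ^+ d * p.@[w 0].
Proof.
move=> /dhomogP hp; rewrite !mevalE mulr_sumr [LHS]big_seq [RHS]big_seq.
apply: eq_bigr => e /hp /= <-; rewrite mulrCA; congr (_ * _).
rewrite mdegE -prodrXr -big_split /=; apply: eq_bigr => l _.
by rewrite mxE exprMn.
Qed.

Lemma ev2_rmorph (K : comNzRingType) (x z : K) :
  ev2 x z =1 (horner_eval z \o map_poly (horner_eval x) : {rmorphism _ -> _}).
Proof. by []. Qed.

Section LinePoly.
Variables (K : closedFieldType) (i j k : 'I_3).
Hypotheses (ij : i != j) (ik : i != k) (jk : j != k).
Variable v : 'rV[K]_3.
Hypothesis vi : v 0 i = 1.

Lemma ord3P (l : 'I_3) : [\/ l = i, l = j | l = k].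
Proof.
have : l \in [set: 'I_3] by rewrite inE.
have -> : [set: 'I_3] = [set i; j; k].
  apply/eqP; rewrite eq_sym eqEcard subsetT cardsT card_ord.
  by rewrite setUC cardsU1 cards2 ij !inE negb_or eq_sym ik eq_sym jk.
by rewrite !inE => /orP[/orP[]|] /eqP; [constructor 1|constructor 2|constructor 3].
Qed.

(* Coordinates in the basis (v, e_j, e_k): the lines through v are the loci
   ycoord = x xcoord, and line_pt x is an affine parameter on such a line, with
   v at infinity. *)
Definition xcoord (w : 'rV[K]_3) := w 0 j - v 0 j * w 0 i.
Definition ycoord (w : 'rV[K]_3) := w 0 k - v 0 k * w 0 i.

Definition line_pt (x z : K) : 'rV[K]_3 := z *: v + 'e_j + x *: 'e_k.

(* F (line_pt x z) as a polynomial in z whose coefficients are polynomials in x. *)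
Definition line_poly (F : {mpoly K[3]}) : {poly {poly K}} :=
  mmap (@polyC {poly K} \o @polyC K)
    (fun l => (v 0 l)%:P%:P * 'X + ((l == j)%:R)%:P%:P + (((l == k)%:R)%:P * 'X)%:P) F.

Lemma xcoord_line_pt x z : xcoord (line_pt x z) = 1.
Proof.
rewrite /xcoord /line_pt !mxE !eqxx vi (negbTE jk) (negbTE ij) (negbTE ik) /=; ring.
Qed.

Lemma ycoord_line_pt x z : ycoord (line_pt x z) = x.
Proof.
by rewrite /ycoord /line_pt !mxE !eqxx vi eq_sym (negbTE jk) (negbTE ij) (negbTE ik) /=; ring.
Qed.

Lemma zeta_line_pt x z : line_pt x z 0 i = z.
Proof. by rewrite /line_pt !mxE eqxx vi (negbTE ij) (negbTE ik) /=; ring. Qed.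

Lemma xcoordZ c (w : 'rV[K]_3) : xcoord (c *: w) = c * xcoord w.
Proof. by rewrite /xcoord !mxE; ring. Qed.

Lemma ycoordZ c (w : 'rV[K]_3) : ycoord (c *: w) = c * ycoord w.
Proof. by rewrite /ycoord !mxE; ring. Qed.

Lemma coordE (w : 'rV[K]_3) : w = w 0 i *: v + xcoord w *: 'e_j + ycoord w *: 'e_k.
Proof.
apply/rowP => l; rewrite !mxE eqxx /xcoord /ycoord /=.
case: (ord3P l) => ->; rewrite ?eqxx ?vi ?(negbTE ij) ?(negbTE ik) ?(negbTE jk);
  rewrite 1?[k == j]eq_sym ?(negbTE jk) /=; ring.
Qed.

Lemma line_ptE (w : 'rV[K]_3) : xcoord w != 0 ->
  w = xcoord w *: line_pt (ycoord w / xcoord w) (w 0 i / xcoord w).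
Proof.
move=> x0; rewrite [LHS]coordE /line_pt !scalerDr !scalerA.
by rewrite !(mulrC (xcoord w)) !divfK.
Qed.

Lemma ev2_line_poly F x z : ev2 x z (line_poly F) = F.@[line_pt x z 0].
Proof.
rewrite ev2_rmorph rmorph_mmap; apply: eq_mmap => [c|l] /=.
  by rewrite map_polyC /= !horner_evalE !hornerC.
rewrite !rmorphD /= !rmorphM /= !map_polyC map_polyX /= !horner_evalE !hornerE.
by rewrite /line_pt !mxE eqxx; ring.
Qed.

Lemma homogenize (D : {poly {poly K}}) : exists e (H : {mpoly K[3]}),
  forall w : 'rV[K]_3, xcoord w != 0 ->
    H.@[w 0] = xcoord w ^+ e * ev2 (ycoord w / xcoord w) (w 0 i / xcoord w) D.
Proof.
pose Xi : {mpoly K[3]} := 'X_j - v 0 j *: 'X_i.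
pose Eta : {mpoly K[3]} := 'X_k - v 0 k *: 'X_i.
have XiE (w : 'rV[K]_3) : Xi.@[w 0] = xcoord w by rewrite mevalB mevalZ !mevalXU.
have EtaE (w : 'rV[K]_3) : Eta.@[w 0] = ycoord w by rewrite mevalB mevalZ !mevalXU.
pose hom D := exists e (H : {mpoly K[3]}), forall w : 'rV[K]_3, xcoord w != 0 ->
    H.@[w 0] = xcoord w ^+ e * ev2 (ycoord w / xcoord w) (w 0 i / xcoord w) D.
have homD A B : hom A -> hom B -> hom (A + B).
  move=> [e [H HE]] [e' [H' HE']]; exists (e + e')%N, (Xi ^+ e' * H + Xi ^+ e * H').
  move=> w w0; rewrite mevalD !mevalM !rmorphXn /= XiE HE // HE' //.
  by rewrite !ev2_rmorph rmorphD exprD; ring.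
have homz A : hom A -> hom (A * 'X).
  move=> [e [H HE]]; exists e.+1, (H * 'X_i) => w w0.
  rewrite mevalM mevalXU HE // !ev2_rmorph rmorphM -!ev2_rmorph.
  have -> : ev2 (ycoord w / xcoord w) (w 0 i / xcoord w) 'X = w 0 i / xcoord w.
    by rewrite /ev2 map_polyX hornerX.
  by rewrite exprS -mulrA; field.
have homx A : hom A%:P -> hom (A * 'X)%:P.
  move=> [e [H HE]]; exists e.+1, (H * Eta) => w w0.
  rewrite mevalM EtaE HE // polyCM !ev2_rmorph rmorphM -!ev2_rmorph.
  have -> : ev2 (ycoord w / xcoord w) (w 0 i / xcoord w) 'X%:P = ycoord w / xcoord w.
    by rewrite /ev2 map_polyC /= hornerC /horner_eval hornerX.
  by rewrite exprS -mulrA; field.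
have homC c : hom c%:P%:P.
  exists 0%N, c%:MP => w w0; rewrite mevalC expr0 mul1r /ev2 map_polyC /= hornerC.
  by rewrite /horner_eval hornerC.
rewrite -/(hom D); elim/poly_ind: D => [|D c IH]; first exact: (homC 0).
apply: (homD); first exact: homz.
elim/poly_ind: c => [|c a IHc]; first exact: (homC 0).
by rewrite polyCD; apply: (homD) => //; apply: (homx).
Qed.

(* The lines through v have equations of this shape, with l = j or l = k. *)
Lemma line_prime (r s : K) (l : 'I_3) (m1 m2 : 'I_3) : l != m1 -> l != m2 ->
  prime_elt ('X_l - r *: 'X_m1 - s *: 'X_m2 : {mpoly K[3]}).
Proof.
move=> lm1 lm2; set L := _ - _.
have nl m' : l != m' -> ('X_m' : {mpoly K[3]}) \mPo
    [tuple 'X_j0 - (j0 == l)%:R *: L | j0 < 3] = 'X_m'.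
  move=> lm; rewrite /comp_mpoly mmapX mmap1U tnth_mktuple eq_sym (negbTE lm).
  by rewrite scale0r subr0.
apply: (@linear_prime _ _ _ l).
  apply/negP => /eqP/(congr1 (meval (fun m' => (m' == l)%:R : K))) /eqP.
  rewrite /L !mevalB !mevalZ !mevalXU meval0 /= eqxx (eq_sym m1) (negbTE lm1).
  by rewrite (eq_sym m2) (negbTE lm2) !mulr0 !subr0 oner_eq0.
have -> y : L \mPo y = ('X_l \mPo y) - r *: ('X_m1 \mPo y) - s *: ('X_m2 \mPo y).
  by rewrite /L !comp_mpolyB !comp_mpolyZ.
rewrite (nl m1) // (nl m2) //.
by rewrite /comp_mpoly mmapX mmap1U tnth_mktuple eqxx scale1r /L; ring.
Qed.

(* After homogenization, a factorization of line_poly F becomes one of F times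
   linear forms through v; these linear forms are prime and can be cancelled. *)
Lemma line_poly_no_factor (F : {mpoly K[3]}) d (c : {poly K}) (D E : {poly {poly K}}) :
    F \is d.-homog -> irreducible_elt F -> c != 0 ->
    c%:P * line_poly F = D * E -> (size D <= 1)%N \/ (size E <= 1)%N.
Proof.
move=> hF [F0 _ Firr] c0 cG.
have [e [H HE]] := homogenize D; have [e' [H' HE']] := homogenize E.
have [r cr] := closed_field_poly_normal c.
have lc : lead_coef c != 0 by rewrite lead_coef_eq0.
pose Xi : {mpoly K[3]} := 'X_j - v 0 j *: 'X_i - 0 *: 'X_i.
pose L t : {mpoly K[3]} := 'X_k - (v 0 k - t * v 0 j) *: 'X_i - t *: 'X_j.
have XiE (w : 'rV[K]_3) : Xi.@[w 0] = xcoord w.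
  by rewrite !mevalB !mevalZ !mevalXU mul0r subr0.
have LE t (w : 'rV[K]_3) : (L t).@[w 0] = ycoord w - t * xcoord w.
  by rewrite !mevalB !mevalZ !mevalXU /ycoord /xcoord; ring.
(* L t is the homogenized form of x - t, for t a root of c. Both sides below carry one spare factor
   [Xi], so that they agree where [xcoord] is 0, out of reach of [homogenize]. *)
pose s := nseq (e + e').+1 Xi ++ [seq L t | t <- r].
have sp l : l \in s -> prime_elt l.
  rewrite mem_cat => /orP[/nseqP[-> _]|/mapP[t _ ->]]; apply: line_prime => //.
  - by rewrite eq_sym.
  - by rewrite eq_sym.
  - by rewrite eq_sym.
  - by rewrite eq_sym.
have Fs : F * \prod_(l <- s) l =
    (Xi ^+ (d + size r).+1 * H) * ((lead_coef c)^-1 *: H').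
  apply: mpoly_eq_eval => w0; pose w : 'rV[K]_3 := \row_l w0 l.
  have wE p : p.@[w0] = p.@[w 0] by apply: meval_eq => l; rewrite mxE.
  rewrite !{}wE; move: w => w.
  have sE : (\prod_(l <- s) l).@[w 0] =
      xcoord w ^+ (e + e').+1 * \prod_(t <- r) (ycoord w - t * xcoord w).
    rewrite rmorph_prod /= big_cat big_map big_nseq iter_mulr_1 XiE; congr (_ * _).
    by apply: eq_bigr => t _; rewrite LE.
  rewrite !mevalM mevalZ sE rmorphXn /= XiE.
  have [xw|xw] := eqVneq (xcoord w) 0; first by rewrite xw !exprS !mul0r mulr0.
  set x := ycoord w / xcoord w; set z := w 0 i / xcoord w.
  have Fw : F.@[w 0] = xcoord w ^+ d * F.@[line_pt x z 0].
    by rewrite -(dhomog_scale _ _ hF) -line_ptE.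
  have prodE : \prod_(t <- r) (ycoord w - t * xcoord w) = xcoord w ^+ size r * \prod_(t <- r) (x - t).
    elim: (r) => [|t r' IH]; first by rewrite !big_nil mulr1.
    by rewrite !big_cons IH /= exprS /x; field.
  have cx : c.[x] = lead_coef c * \prod_(t <- r) (x - t).
    rewrite {1}cr hornerZ horner_prod; congr (_ * _); apply: eq_bigr => t _.
    by rewrite !hornerE.
  have ev : c.[x] * F.@[line_pt x z 0] = ev2 x z D * ev2 x z E.
    rewrite !ev2_rmorph -rmorphM -cG rmorphM -!ev2_rmorph ev2_line_poly.
    by rewrite /ev2 map_polyC /= hornerC.
  rewrite HE // HE' // -/x -/z Fw prodE.
  transitivity (xcoord w ^+ (d + size r).+1 * xcoord w ^+ (e + e')
     * ((lead_coef c)^-1 * (ev2 x z D * ev2 x z E))).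
    rewrite -ev cx !exprS !exprD; by field.
  by rewrite !exprD; ring.
have [D1 [E1 [s1 [s2 [h1 h2 h3 h4]]]]] := split_prime_factors sp Fs.
(* The forms in s vanish at v, so they are constant in z on each line through v: a factor composed
   of them and a constant has degree 0 in z. *)
have sp_const (l : {mpoly K[3]}) x z : l \in s -> l.@[line_pt x z 0] = l.@[line_pt x 0 0].
  rewrite mem_cat => /orP[/nseqP[-> _]|/mapP[t _ ->]]; rewrite ?XiE ?LE ?xcoord_line_pt ?ycoord_line_pt //.
have ev_line x z : Xi.@[line_pt x z 0] = 1 by rewrite XiE xcoord_line_pt.
have HD x z : H.@[line_pt x z 0] = ev2 x z D.
  by rewrite HE xcoord_line_pt ?oner_eq0 // ycoord_line_pt zeta_line_pt !divr1 expr1n mul1r.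
have HD' x z : H'.@[line_pt x z 0] = ev2 x z E.
  by rewrite HE' xcoord_line_pt ?oner_eq0 // ycoord_line_pt zeta_line_pt !divr1 expr1n mul1r.
have prod_const (t : seq {mpoly K[3]}) x z : {subset t <= s} ->
    (\prod_(l <- t) l).@[line_pt x z 0] = (\prod_(l <- t) l).@[line_pt x 0 0].
  move=> ts; rewrite !rmorph_prod /= big_seq [RHS]big_seq; apply: eq_bigr => l /ts.
  exact: sp_const.
have s1s : {subset s1 <= s} by move=> m ms; apply: h4; rewrite mem_cat ms.
have s2s : {subset s2 <= s} by move=> m ms; apply: h4; rewrite mem_cat ms orbT.
case: (Firr _ _ h1) => /mpoly_unit_const[a a0 ea]; [left|right]; apply: ev2_const => x z.
  have HX z' : ev2 x z' D = (Xi ^+ (d + size r).+1 * H).@[line_pt x z' 0].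
    by rewrite mevalM rmorphXn /= ev_line expr1n mul1r HD.
  by rewrite !HX h2 ea !mevalM !mevalC prod_const.
have HX z' : ev2 x z' E = lead_coef c * ((lead_coef c)^-1 *: H').@[line_pt x z' 0].
  by rewrite mevalZ mulVKf // HD'.
by rewrite !HX h3 ea !mevalM !mevalC prod_const.
Qed.

End LinePoly.

(** * Distinct intersections of the curve with a generic line through a point *)

Lemma poly_roots_seq (K : closedFieldType) (p : {poly K}) : p != 0 ->
  exists bad : seq K, forall x, (x \in bad) = root p x.
Proof.
move=> p0; have [r er] := closed_field_poly_normal p; exists r => x.
by rewrite er rootZ ?lead_coef_eq0 // root_prod_XsubC.
Qed.

Section Order.
Variables (K : closedFieldType).
Hypothesis charK : [pchar K] =i pred0.
Variables (i j k : 'I_3).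
Hypotheses (ij : i != j) (ik : i != k) (jk : j != k).
Variable v : 'rV[K]_3.
Hypothesis vi : v 0 i = 1.
Variables (F : {mpoly K[3]}) (d : nat).
Hypotheses (hF : F \is d.-homog) (irrF : irreducible_elt F).

Let G := line_poly j k v F.

Lemma line_poly_neq0 : G != 0.
Proof.
apply/negP => /eqP G0.
(* Only points with nonzero [xcoord] are multiples of some [line_pt]; this linear factor covers the
   others. *)
have : F * ('X_j - v 0 j *: 'X_i) = 0.
  apply: mpoly_eq_eval => w0; pose w : 'rV[K]_3 := \row_l w0 l.
  have wE p : p.@[w0] = p.@[w 0] by apply: meval_eq => l; rewrite mxE.
  rewrite !{}wE; move: w => w; rewrite mevalM mevalB mevalZ !mevalXU -/(xcoord i j v w) meval0.
  have [->|xw] := eqVneq (xcoord i j v w) 0; first by rewrite mulr0.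
  rewrite [in F.@[_]](line_ptE ij ik jk vi xw) (dhomog_scale _ _ hF).
  by rewrite -(ev2_line_poly _ _ v) -/G G0 /ev2 raddf0 horner0 mulr0 mul0r.
have [X0 _] := line_prime (v 0 j) 0 (m1 := i) (m2 := i) (l := j)
  ltac:(by rewrite eq_sym) ltac:(by rewrite eq_sym).
have [F0 _ _] := irrF.
move: X0; rewrite scale0r subr0 => X0 /eqP.
by rewrite mulf_eq0 (negbTE F0) (negbTE X0).
Qed.

(** G and its derivative in z have no common factor of positive degree in z, so some nonzero r in
    K[x] is a combination of them. Where neither r nor the leading coefficient of G vanishes, all
    roots in z are simple. *)
Lemma generic_roots : exists bad : seq K, forall x, x \notin bad ->
  exists zs, [/\ uniq zs, size zs = (size G).-1 &
    forall z, (z \in zs) = (F.@[line_pt j k v x z 0] == 0)].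
Proof.
have lG : lead_coef G != 0 by rewrite lead_coef_eq0 line_poly_neq0.
have [b0 b0P] := poly_roots_seq lG.
have Gx x : x \notin b0 -> size (map_poly (horner_eval x) G) = size G.
  by rewrite b0P rootE => h; rewrite size_map_poly_id0.
have evG x z : root (map_poly (horner_eval x) G) z = (F.@[line_pt j k v x z 0] == 0).
  by rewrite rootE -ev2_line_poly.
case: (leqP (size G) 1) => sG.
  exists b0 => x /Gx sx; exists [::]; split=> //; first by case: (size G) sG => [|[]].
  move=> z; rewrite -evG in_nil; apply/esym/negbTE; apply/negP => /root_size_gt1.
  rewrite -size_poly_gt0 sx size_poly_gt0 line_poly_neq0 => /(_ isT).
  by rewrite ltnNge sG.
have G'0 : G^`() != 0.
  apply/negP => /eqP/(congr1 (fun q : {poly {poly K}} => q`_(size G).-2)).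
  rewrite coef_deriv coef0 prednK ?ltn_predRL // -lead_coefE => /eqP.
  rewrite -mulr_natr mulf_eq0 (negbTE lG) /= -polyC_natr polyC_eq0.
  by case: (size G) sG => [|[|s]] // _; rewrite (negbTE (natr_neq0 charK s)).
have sG' : (size G^`() < size G)%N by rewrite lt_size_deriv // line_poly_neq0.
have [r [A [B [r0 eAB]]]] : exists r : {poly K}, exists A B : {poly {poly K}},
    r != 0 /\ r%:P = A * G + B * G^`().
  have R0 : resultant G G^`() != 0.
    rewrite resultant_eq0 -leqNgt; set g := gcdp _ _.
    have gG : g %| G by apply: dvdp_gcdl.
    have gG' : g %| G^`() by apply: dvdp_gcdr.
    have [[c Q] /= c0 e] := Pdiv.Idomain.dvdpP _ _ gG.
    have [] := line_poly_no_factor ij ik jk vi hF irrF (c := c) (D := Q) (E := g) c0.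
    - by rewrite mul_polyC.
    (* A cofactor Q of degree 0 in z would give g the size of G, but g divides the derivative. *)
    - move=> sQ; have : (size g < size G)%N by apply: leq_ltn_trans (dvdp_leq G'0 gG') sG'.
      have := congr1 (fun q : {poly {poly K}} => size q) e.
      rewrite /= size_scale // => ->; rewrite ltnNge => /negP[].
      apply: leq_trans (size_polyMleq _ _) _.
      by move: sQ; case: (size Q) => [|[]] //= _; rewrite leq_pred.
    - by [].
  (* [resultant_in_ideal] requires positive degrees; a derivative of degree 0 in z is itself the
     element r. *)
  case: (leqP (size G^`()) 1) => s1.
    exists (G^`()`_0), 0, 1; rewrite mul0r add0r mul1r -size1_polyC //; split=> //.
    by move: G'0; rewrite {1}(size1_polyC s1) polyC_eq0.
  have [[A B] /= _ e] := resultant_in_ideal sG s1.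
  by exists (resultant G G^`()), A, B.
have [b1 b1P] := poly_roots_seq r0; exists (b0 ++ b1) => x.
rewrite mem_cat negb_or => /andP[xb0 xb1]; have sx := Gx _ xb0.
have Gx0 : map_poly (horner_eval x) G != 0.
  by rewrite -size_poly_eq0 sx size_poly_eq0 line_poly_neq0.
have [|zs [h1 h2 h3]] := simple_roots Gx0.
  move=> z Gz; apply/negP => G'z; move: xb1; rewrite b1P => /negP; apply.
  have := congr1 (ev2 x z) eAB; rewrite !ev2_rmorph rmorphD !rmorphM -!ev2_rmorph.
  rewrite {1}/ev2 map_polyC /= hornerC horner_evalE => e; apply/rootP; rewrite e.
  move/rootP: Gz; rewrite -/(ev2 x z G) => ->.
  move/rootP: G'z; rewrite deriv_map -/(ev2 x z G^`()) => ->.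
  by rewrite !mulr0 addr0.
by exists zs; split; rewrite ?h2 ?sx // => z; rewrite h3 evG.
Qed.
End Order.

(** * Multiplicity *)

Lemma mcoeff_pihomog (R : nzRingType) m t (p : {mpoly R[m]}) e :
  (pihomog mdeg t p)@_e = if mdeg e == t then p@_e else 0.
Proof.
rewrite pihomogE raddf_sum /= big_mkcond [in RHS](mpolyE p) raddf_sum /=.
case: ifP => et.
  apply: eq_bigr => e' _; rewrite mcoeffZ mcoeffX; case: (e' =P e) => [->|].
    by rewrite et.
  by rewrite mulr0 if_same.
rewrite big1 // => e' _; case: ifP => // e't; rewrite mcoeffZ mcoeffX.
by case: (e' =P e) => [e'e|]; rewrite ?mulr0 //; move: et e't; rewrite e'e => ->.
Qed.

Lemma poly_eq_eval (K : closedFieldType) (p q : {poly K}) :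
  (forall x, p.[x] = q.[x]) -> p = q.
Proof.
move=> pq; apply/eqP; rewrite -subr_eq0; apply/negPn/negP => /(poly_nz_point [::]).
by case=> x _; rewrite rootE hornerD hornerN pq subrr eqxx.
Qed.

Lemma homog_parts_scale (K : comNzRingType) m (p : {mpoly K[m]}) N y (w : 'rV[K]_m) :
  (msize p <= N)%N ->
  p.@[(y *: w) 0] = \sum_(t < N) (pihomog mdeg t p).@[w 0] * y ^+ t.
Proof.
move=> pN; rewrite {1}(pihomog_partitionE (mf := mdeg) pN) meval_sum.
apply: eq_bigr => t _; rewrite mulrC; apply: dhomog_scale; exact: pihomogP.
Qed.

Section LocalOrder.
Variables (K : closedFieldType).
Variables (i j k : 'I_3).
Hypotheses (ij : i != j) (ik : i != k) (jk : j != k).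
Variable v : 'rV[K]_3.
Hypothesis vi : v 0 i = 1.
Variables (F : {mpoly K[3]}) (d : nat).
Hypotheses (hF : F \is d.-homog) (irrF : irreducible_elt F).

Let G := line_poly j k v F.
Let L := local_equation F v i.

Lemma local_equationE (w : 'rV[K]_3) :
  L.@[w 0] = F.@[(v + (w - w 0 i *: 'e_i)) 0].
Proof.
rewrite comp_mpoly_meval; apply: meval_eq => l; rewrite tnth_mktuple !mxE eqxx /=.
case: eqP => [->|_]; first by rewrite mevalC mulr1 subrr addr0.
by rewrite mevalD mevalXU mevalC mulr0 subr0 addrC.
Qed.

(** L does not involve X_i; comparing L(y w) for both vectors as polynomials in y passes this on to
    each homogeneous part. *)
Lemma homog_part_no_i t (w : 'rV[K]_3) :
  (pihomog mdeg t L).@[w 0] = (pihomog mdeg t L).@[(w - w 0 i *: 'e_i) 0].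
Proof.
set w' := w - _.
have w'i : w' 0 i = 0 by rewrite /w' !mxE !eqxx mulr1 subrr.
have lE y : L.@[(y *: w) 0] = L.@[(y *: w') 0].
  rewrite !local_equationE; congr (F.@[_ 0]); congr (v + _).
  by rewrite [(y *: w') 0 i]mxE [(y *: w) 0 i]mxE w'i mulr0 scale0r subr0 /w' scalerBr scalerA mulrC.
pose N := maxn t.+1 (msize L).
have pE (u : 'rV[K]_3) y : L.@[(y *: u) 0] =
    (\poly_(s < N) (pihomog mdeg s L).@[u 0]).[y].
  by rewrite (homog_parts_scale _ _ (leq_maxr t.+1 _)) horner_poly.
have /(congr1 (fun q : {poly K} => q`_t)) : \poly_(s < N) (pihomog mdeg s L).@[w 0] =
    \poly_(s < N) (pihomog mdeg s L).@[w' 0].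
  by apply: poly_eq_eval => y; rewrite -!pE.
by rewrite !coef_poly leq_max ltnSn.
Qed.

(** By homogeneity F(z v + u) = z^d L(u / z) for u with u_i = 0; expand L into homogeneous parts and
    clear the denominators by z^N. *)
Lemma coef_line_poly x q N : (msize L <= N)%N -> (0 < N)%N ->
  (G`_q).[x] =
    \sum_(t < N) if (q + t == d)%N then (pihomog mdeg t L).@[('e_j + x *: 'e_k : 'rV[K]_3) 0] else 0.
Proof.
move=> LN N0; set u := _ + _.
have ui : u 0 i = 0 by rewrite /u !mxE eqxx /= (negbTE ij) (negbTE ik) mulr0 addr0.
have E : 'X^N * map_poly (horner_eval x) G =
    'X^d * \sum_(t < N) ((pihomog mdeg t L).@[u 0])%:P * 'X^(N - t).
  apply: poly_eq_eval => z; rewrite !hornerM !hornerXn -[(map_poly _ G).[z]]/(ev2 x z G).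
  rewrite (ev2_line_poly _ _ v) horner_sum.
  have [->|z0] := eqVneq z 0.
    rewrite expr0n eqn0Ngt N0 mul0r big1 ?mulr0 // => t _.
    by rewrite hornerM hornerXn expr0n subn_eq0 leqNgt ltn_ord mulr0.
  have -> : line_pt j k v x z = z *: (v + z^-1 *: u).
    by rewrite scalerDr scalerA divff // scale1r /line_pt addrA.
  rewrite (dhomog_scale _ _ hF) mulrCA; congr (_ * _).
  have -> : F.@[(v + z^-1 *: u) 0] = L.@[(z^-1 *: u) 0].
    by rewrite local_equationE [(z^-1 *: u) 0 i]mxE ui mulr0 scale0r subr0.
  rewrite (homog_parts_scale _ _ LN) mulr_sumr; apply: eq_bigr => t _.
  rewrite hornerM hornerXn hornerC mulrCA exprVn -expfB_cond ?mulrA //.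
  by rewrite (negbTE z0) add0n ltnW.
have := congr1 (fun p : {poly K} => p`_(N + q)) E.
rewrite coefXnM ltnNge leq_addr addKn coef_map /= horner_evalE => ->.
rewrite mulr_sumr coef_sum; apply: eq_bigr => t _.
rewrite mulrCA coefCM -exprD coefXn.
have -> : (N + q == d + (N - t))%N = (q + t == d)%N by have := ltn_ord t; lia.
by case: eqP; rewrite ?mulr1 ?mulr0.
Qed.

(* On the lines through v, the part of degree t of the local equation at v
   becomes the coefficient of z^(d - t). *)
Lemma order_size m : order_at_origin L m -> (m <= d)%N /\ size G = (d - m).+1.
Proof.
move=> [lt_m [e em Le]].
have mN : (mdeg e < msize L)%N by apply: msize_mdeg_lt; rewrite mcoeff_msupp.
move: mN; rewrite em => mN; set N := msize L in mN.
have N0 : (0 < N)%N by apply: leq_ltn_trans mN.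
have low t : (t < m)%N -> pihomog mdeg t L = 0.
  move=> tm; apply/mpolyP => e'; rewrite mcoeff_pihomog mcoeff0.
  by case: eqP => // et; apply: lt_m; rewrite et.
have Lm : pihomog mdeg m L != 0.
  by apply/negP => /eqP/mpolyP/(_ e); rewrite mcoeff_pihomog em eqxx mcoeff0; apply/eqP.
have [x Lx] : exists x : K, (pihomog mdeg m L).@[('e_j + x *: 'e_k : 'rV[K]_3) 0] != 0.
  have [w0] : exists w : 'I_3 -> K, (pihomog mdeg m L * 'X_j).@[w] != 0.
    (* The factor X_j provides a point with w_j nonzero, which can be rescaled to the form e_j + x
       e_k. *)
    by apply: mpoly_nz_point; rewrite mulf_neq0 // -msize_poly_eq0 msizeX.
  pose w : 'rV[K]_3 := \row_l w0 l.
  have wE p : p.@[w0] = p.@[w 0] by apply: meval_eq => l; rewrite mxE.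
  rewrite {}wE; move: w => w; rewrite mevalM mevalXU mulf_eq0 negb_or => /andP[Lw wj].
  exists (w 0 k / w 0 j); apply: contraNneq Lw => Lx; rewrite homog_part_no_i.
  have -> : w - w 0 i *: 'e_i = w 0 j *: ('e_j + (w 0 k / w 0 j) *: 'e_k).
    rewrite scalerDr scalerA mulrCA divff // mulr1; apply/rowP => l; rewrite !mxE eqxx /=.
    case: (ord3P ij ik jk l) => ->; rewrite ?eqxx ?(negbTE ij) ?(negbTE ik) ?(negbTE jk)
      1?[j == i]eq_sym 1?[k == i]eq_sym 1?[k == j]eq_sym
      ?(negbTE ij) ?(negbTE ik) ?(negbTE jk) /=; ring.
  by rewrite (dhomog_scale _ _ (pihomogP _ _ _)) Lx mulr0.
have md : (m <= d)%N.
  rewrite leqNgt; apply/negP => dm; have /negP[] := line_poly_neq0 ij ik jk vi hF irrF.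
  apply/eqP/polyP => q; rewrite coef0; apply: poly_eq_eval => y; rewrite horner0.
  rewrite (coef_line_poly _ _ (leqnn _) N0) big1 // => t _; case: eqP => // qt.
  by rewrite low ?meval0 //; lia.
split=> //; apply/anti_leq/andP; split.
  apply/leq_sizeP => q dq; apply: poly_eq_eval => y; rewrite horner0.
  rewrite (coef_line_poly _ _ (leqnn _) N0) big1 // => t _; case: eqP => // qt.
  by rewrite low ?meval0 //; lia.
rewrite ltnNge; apply/negP => /leq_sizeP/(_ _ (leqnn _)).
move/(congr1 (fun p : {poly K} => p.[x])); rewrite horner0.
rewrite (coef_line_poly _ _ (leqnn _) N0) (bigD1 (Ordinal mN)) //= subnK // eqxx.
rewrite big1 ?addr0; first by apply/eqP.
move=> t /eqP tm; case: eqP => // qt; case: tm; apply: val_inj => /=.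
by apply/eqP; rewrite -(eqn_add2l (d - m)) qt subnK.
Qed.

Lemma order_exists : exists m, order_at_origin L m.
Proof.
have L0 : L != 0.
  apply/negP => /eqP L0; have /negP[] := line_poly_neq0 ij ik jk vi hF irrF.
  apply/eqP/polyP => q; rewrite coef0; apply: poly_eq_eval => x; rewrite horner0.
  rewrite (@coef_line_poly _ _ 1%N) ?L0 ?msize0 // big1 // => t _.
  by rewrite raddf0 meval0 if_same.
have ex : exists t, has (fun e => mdeg e == t) (msupp L).
  exists (mdeg (mlead L)); apply/hasP; exists (mlead L) => //; exact: mlead_supp.
case: (ex_minnP ex) => m /hasP[e eL /eqP em] min; exists m; split=> [e' e'm|].
  apply/eqP; rewrite -[_ == 0]negbK -mcoeff_msupp; apply/negP => e'L.
  by move: e'm; rewrite ltnNge min //; apply/hasP; exists e'.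
by exists e => //; rewrite -mcoeff_msupp.
Qed.

End LocalOrder.

(** * Partial derivatives and singular points *)

Lemma mpoly_ring_ind (R : comNzRingType) m (Q : {mpoly R[m]} -> Prop) :
    (forall c, Q c%:MP) -> (forall l, Q 'X_l) ->
    (forall p q, Q p -> Q q -> Q (p + q)) -> (forall p q, Q p -> Q q -> Q (p * q)) ->
  forall p, Q p.
Proof.
move=> QC QX QD QM p; rewrite [p]mpolyE.
elim/big_ind: _ => [|p1 p2|e _]; first by rewrite -mpolyC0.
  exact: QD.
rewrite -mul_mpolyC; apply: (QM) => //; rewrite mpolyXE_id.
elim/big_ind: _ => [|p1 p2|l _]; first by rewrite -mpolyC1.
  exact: (QM).
by elim: (e l) => [|s IH]; [rewrite expr0 -mpolyC1|rewrite exprS; apply: (QM)].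
Qed.

Lemma euler_homog (R : comNzRingType) m d (p : {mpoly R[m]}) : p \is d.-homog ->
  \sum_(l < m) 'X_l * p^`M(l) = p *+ d.
Proof.
move=> /dhomogP hp; rewrite {2}[p]mpolyE -sumrMnl.
transitivity (\sum_(l < m) \sum_(e <- msupp p) p@_e *: ('X_l * 'X_[e]^`M(l))).
  apply: eq_bigr => l _; rewrite {1}[p]mpolyE raddf_sum mulr_sumr /=.
  by apply: eq_bigr => e _; rewrite mderivZ scalerAr.
rewrite exchange_big /= big_seq [RHS]big_seq; apply: eq_bigr => e /hp /= ed.
rewrite -scaler_sumr scalerMnr; congr (_ *: _); rewrite -ed mdegE -sumrMnr.
apply: eq_bigr => l _; rewrite mderivX -scalerAr -mpolyXD.
case E: (e l) => [|s]; first by rewrite scale0r mulr0n.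
rewrite -scaler_nat; congr (_ *: 'X_[_]).
apply/mnmP => l'; rewrite mnmDE mnmBE mnm1E.
by case: eqP => [<-|]; rewrite ?E /= ?subn0 // subn1.
Qed.

Section SingOrder.
Variables (K : closedFieldType) (i : 'I_3) (v : 'rV[K]_3).
Hypothesis vi : v 0 i = 1.
Variables (F : {mpoly K[3]}) (d : nat).
Hypothesis hF : F \is d.-homog.

Lemma local_equation_deriv p l : (local_equation p v i)^`M(l) =
  (l != i)%:R *: local_equation p^`M(l) v i.
Proof.
have lM q r : local_equation (q * r) v i = local_equation q v i * local_equation r v i.
  exact: (rmorphM (mmap (@mpolyC 3 K) _)).
have lD q r : local_equation (q + r) v i = local_equation q v i + local_equation r v i.
  exact: comp_mpolyD.
have submm : (U_(l) - U_(l))%MM = 0%MM :> 'X_{1..3}.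
  by apply/mnmP => l'; rewrite mnmBE subnn mnm0E.
elim/mpoly_ring_ind: p => [c|l'|p q IHp IHq|p q IHp IHq].
- by rewrite /local_equation comp_mpolyC !mderivC comp_mpoly0 scaler0.
- rewrite /local_equation {1}/comp_mpoly mmapX mmap1U tnth_mktuple.
  rewrite mderivX mnm1E.
  case: (eqVneq l' l) => [->|ne]; rewrite ?scale0r ?comp_mpoly0 ?scaler0.
    rewrite submm mpolyX0 scale1r comp_mpoly1; case: eqP => _ /=.
      by rewrite mderivC scale0r.
    by rewrite mderivD mderivC addr0 mderivX mnm1E eqxx submm mpolyX0.
  case: eqP => _; first by rewrite mderivC.
  by rewrite mderivD mderivC addr0 mderivX mnm1E (negbTE ne) scale0r.
- by rewrite lD !mderivD lD IHp IHq scalerDr.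
- by rewrite lM !mderivM lD !lM IHp IHq scalerDr scalerAl scalerAr.
Qed.

Lemma local_equation_at0 p : (local_equation p v i)@_0 = p.@[v 0].
Proof.
have -> : (local_equation p v i)@_0 = (local_equation p v i).@[(0 : 'rV[K]_3) 0].
  move: (local_equation p v i) => q; elim/mpoly_ring_ind: q => [c|l|q r IHq IHr|q r IHq IHr].
  - by rewrite mevalC mcoeffC eqxx mulr1.
  - by rewrite mevalXU mxE mcoeffX; case: eqP => // /mnmP/(_ l); rewrite mnm1E mnm0E eqxx.
  - by rewrite mcoeffD mevalD IHq IHr.
  - by rewrite mevalM rmorphM /= IHq IHr.
by rewrite local_equationE [(0 : 'rV[K]_3) 0 i]mxE scale0r subrr addr0.
Qed.

(** The terms of degree at most 1 of the local equation are F(v) and the partial derivatives other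
    than the i-th; the i-th one follows from Euler's identity, as v_i = 1. *)
Lemma sing_order m : order_at_origin (local_equation F v i) m ->
  (F.@[v 0] = 0 /\ forall l, F^`M(l).@[v 0] = 0) <-> (2 <= m)%N.
Proof.
have c1 l : (local_equation F v i)@_U_(l) = (l != i)%:R * F^`M(l).@[v 0].
  rewrite -local_equation_at0 -mcoeffZ -local_equation_deriv mcoeff_deriv.
  by rewrite add0m mnm0E.
move=> [lt_m [e em Le]]; split=> [[F0 dF0]|m2].
  rewrite leqNgt -em; apply: contra Le; rewrite ltnS leq_eqVlt ltnS leqn0.
  case/orP => [/mdeg1P[l /eqP ->]|]; first by rewrite c1 dF0 mulr0.
  by rewrite mdeg_eq0 => /eqP ->; rewrite local_equation_at0 F0.
have F0 : F.@[v 0] = 0 by rewrite -local_equation_at0 lt_m // mdeg0 ltnW.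
have dF0 l : l != i -> F^`M(l).@[v 0] = 0.
  by move=> li; have := c1 l; rewrite li mul1r => <-; apply: lt_m; rewrite mdeg1.
split=> // l; have [->|/dF0//] := eqVneq l i.
have := congr1 (meval (v 0)) (euler_homog hF).
rewrite /= mevalMn F0 mul0rn meval_sum (bigD1 i) //= big1 ?addr0.
  by rewrite mevalM mevalXU vi mul1r.
by move=> l' /dF0 e0; rewrite mevalM e0 mulr0.
Qed.
End SingOrder.

(** * Parameterized curves *)

Lemma ord3_others (i : 'I_3) : exists j k : 'I_3, [/\ i != j, i != k & j != k].
Proof.
exists (lift i ord0), (lift i (@ord_max 1)); split; rewrite ?neq_lift //.
by rewrite (inj_eq lift_inj).
Qed.

Section Curve.
Variable K : closedFieldType.
Hypothesis charK : [pchar K] =i pred0.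
Variables (F : {mpoly K[3]}) (d : nat).
Hypotheses (hF : F \is d.-homog) (irrF : irreducible_elt F).

Lemma homog_scale_eq0 (c : K) (w : 'rV[K]_3) : c != 0 ->
  (F.@[(c *: w) 0] == 0) = (F.@[w 0] == 0).
Proof.
by move=> c0; rewrite (dhomog_scale _ _ hF) mulf_eq0 expf_eq0 (negbTE c0) andbF.
Qed.

Lemma degree_gt0 : (0 < d)%N.
Proof.
case: (posnP d) => // d0; case: irrF => F0 Fu _; case/negP: Fu.
have FC : F = (F@_0)%:MP.
  apply/mpolyP => e; rewrite mcoeffC; case: eqP => [<-|ne]; first by rewrite mulr1.
  rewrite mulr0; apply: (dhomog_nemf_coeff hF); rewrite d0 mdeg_eq0.
  by apply/eqP => e0; case: ne.
rewrite FC; apply: (rmorph_unit (@mpolyC 3 K)); rewrite unitfE.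
by apply: contraNneq F0 => F0; rewrite FC F0 mpolyC0.
Qed.

Lemma off_curve : exists (i : 'I_3) (v : 'rV[K]_3), v 0 i = 1 /\ F.@[v 0] != 0.
Proof.
have [F0 _ _] := irrF; have [w0] := mpoly_nz_point F0.
pose w : 'rV[K]_3 := \row_l w0 l.
have -> : F.@[w0] = F.@[w 0] by apply: meval_eq => l; rewrite mxE.
move: w => w Fw; have /rV0Pn[i wi] : w != 0.
  apply: contraNneq Fw => ->; rewrite -(scale0r w) (dhomog_scale _ _ hF).
  by rewrite expr0n eqn0Ngt degree_gt0 mul0r.
exists i, ((w 0 i)^-1 *: w); rewrite mxE mulVf //; split=> //.
by rewrite homog_scale_eq0 // invr_eq0.
Qed.

Lemma off_curve_order i (v : 'rV[K]_3) m : F.@[v 0] != 0 ->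
  order_at_origin (local_equation F v i) m -> m = 0%N.
Proof.
move=> Fv [lt_m _]; case: (posnP m) => // m0; move: Fv.
by rewrite -(local_equation_at0 i) lt_m ?eqxx // mdeg0.
Qed.

(** A point other than v lies on one line through v only, so avoiding a point costs one value of
    x. *)
Lemma line_pt_scaled (i j k : 'I_3) (v b : 'rV[K]_3) x z c :
    i != j -> i != k -> j != k -> v 0 i = 1 ->
  line_pt j k v x z = c *: b -> x = ycoord i k v b / xcoord i j v b.
Proof.
move=> ij ik jk vi e.
have e1 := xcoord_line_pt ij ik jk vi x z; have e2 := ycoord_line_pt ij ik jk vi x z.
move: e1 e2; rewrite e xcoordZ ycoordZ => e1 <-.
have b0 : xcoord i j v b != 0 by apply: contra_eq_neq e1 => ->; rewrite mulr0 eq_sym oner_eq0.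
by apply: (mulIf b0); rewrite divfK // mulrAC e1 mul1r.
Qed.

Lemma line_pt_neq0 (i j k : 'I_3) (v : 'rV[K]_3) x z :
  i != j -> i != k -> j != k -> v 0 i = 1 -> line_pt j k v x z != 0.
Proof.
move=> ij ik jk vi; apply/negP => /eqP e0.
have := xcoord_line_pt ij ik jk vi x z; rewrite e0 /xcoord !mxE mulr0 subrr => /eqP.
by rewrite eq_sym oner_eq0.
Qed.

(** From a point v off C, a generic line meets C in d > 0 points, and it can be chosen away from the
    points of S. *)
Lemma zeros_infinite (S : seq 'rV[K]_3) : exists w : 'rV[K]_3,
  [/\ w != 0, F.@[w 0] = 0 & forall b c, b \in S -> w != c *: b].
Proof.
have [i [v [vi Fv]]] := off_curve; have [j [k [ij ik jk]]] := ord3_others i.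
have [m om] := order_exists ij ik jk vi hF irrF.
have [_ sG] := order_size ij ik jk vi hF irrF om.
rewrite (off_curve_order Fv om) subn0 in sG.
have [bad badP] := generic_roots charK ij ik jk vi hF irrF.
have [x] := closed_field_fresh (bad ++ [seq ycoord i k v b / xcoord i j v b | b <- S]).
rewrite mem_cat negb_or => /andP[/badP[zs [_ szs zsP]] xS].
have : nth 0 zs 0 \in zs by rewrite mem_nth // szs sG degree_gt0.
set z := nth _ _ _; rewrite zsP => /eqP Fz; exists (line_pt j k v x z).
split=> //; first exact: (line_pt_neq0 _ _ ij ik jk vi).
move=> b c bS; apply: contra xS => /eqP e; apply/mapP; exists b => //.
exact: line_pt_scaled e.
Qed.

Variables (n : nat) (a : 'M[K]_(3, n.+1)).
Hypothesis base_free : forall t, a *m moment n t != 0.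
Hypothesis base_free_infty : a *m moment_infty K n != 0.

Definition point_at (t : K) : 'rV[K]_3 := (a *m moment n t)^T.
Definition point_infty : 'rV[K]_3 := (a *m moment_infty K n)^T.

Hypothesis zero_image : forall w : 'rV[K]_3, w != 0 -> F.@[w 0] = 0 ->
  (exists t c, w = c *: point_at t) \/ (exists c, w = c *: point_infty).
Hypothesis image_zero : forall t, F.@[point_at t 0] = 0.
(** [B] collects the points that may have several finite parameters. The parameter at infinity is
    kept apart, by adding [point_infty] to the points to be avoided. *)
Variable B : seq 'rV[K]_3.
Hypothesis gen_inj : forall t t' c, point_at t = c *: point_at t' ->
  t = t' \/ exists2 b, b \in B & exists c, point_at t = c *: b.

Lemma pullback_eval (l : 'rV[K]_3) t : (pullback a l).[t] = (l *m (point_at t)^T) 0 0.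
Proof. by rewrite trmxK mulmxA moment_eval mxE eqxx mulr1n. Qed.

Lemma pullback_lin c (l l' : 'rV[K]_3) :
  pullback a (c *: l + l') = c *: pullback a l + pullback a l'.
Proof. by rewrite /pullback mulmxDl -scalemxAl linearP. Qed.

Lemma size_pullback (l : 'rV[K]_3) : (size (pullback a l) <= n.+1)%N.
Proof. exact: size_rVpoly. Qed.

Lemma point_at_neq0 t : point_at t != 0.
Proof. by rewrite trmx_eq0. Qed.

Lemma common_factor_root k (v : 'rV[K]_3) g t : v != 0 -> common_factor a k v g ->
  root g t -> exists2 c, c != 0 & point_at t = c *: v.
Proof.
move=> v0 [_ _ gl] gt.
have [c e] : exists c, (point_at t)^T = c *: v^T.
  apply: perp_scalar => // l /gl[p _ e]; apply/matrixP => i' j'.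
  by rewrite !ord1 -pullback_eval e hornerM (rootP gt) mulr0 mxE.
have {}e : point_at t = c *: v by apply: trmx_inj; rewrite e linearZ.
by exists c => //; apply: contraNneq (point_at_neq0 t) => c0; rewrite e c0 scale0r.
Qed.

(** As a form of degree k, a polynomial of size at most k vanishes at (0:1), hence so do the
    pullbacks of all lines through v. *)
Lemma common_factor_infty k (v : 'rV[K]_3) g : (0 < k <= n)%N -> v != 0 ->
  common_factor a k v g -> (size g <= k)%N -> exists2 c, c != 0 & point_infty = c *: v.
Proof.
move=> kn v0 [g0 _ gl] sg.
have [c e] : exists c, (point_infty)^T = c *: v^T.
  apply: perp_scalar => // l /gl[p sp e]; rewrite trmxK mulmxA moment_infty_eval.
  rewrite -/(pullback a l) e nth_default ?raddf0 //.
  by apply: leq_trans (size_polyMleq _ _) _; lia.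
have {}e : point_infty = c *: v by apply: trmx_inj; rewrite e linearZ.
exists c => //; apply: contraNneq base_free_infty => c0.
by rewrite -trmx_eq0 -/point_infty e c0 scale0r.
Qed.

Lemma has_factor0 v : has_factor a 0 v.
Proof.
exists 1; split; rewrite ?oner_eq0 ?size_poly1 // => l _.
by exists (pullback a l); rewrite ?mulr1 // subn0 size_pullback.
Qed.

(** One linear factor is moved to the cofactors: the one at infinity if the size of g is at most k +
    1, which leaves g unchanged, otherwise one at a root of g. *)
Lemma has_factor_pred k v : (k < n)%N -> has_factor a k.+1 v -> has_factor a k v.
Proof.
move=> kn [g [g0 sg gl]]; case: (leqP (size g) k.+1) => sgk.
  exists g; split=> // l /gl[c sc e]; exists c => //; apply: leq_trans sc _.
  by rewrite ltnS leq_sub2l.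
have {}sg : size g = k.+2 by apply/anti_leq; rewrite sg.
have /closed_rootP[r /factor_theorem[q e]] : size g != 1%N by rewrite sg.
have q0 : q != 0 by apply: contraNneq g0 => q0; rewrite e q0 mul0r.
have sq : size q = k.+1 by move: sg; rewrite e size_Mmonic ?monicXsubC // size_XsubC addn2 => -[].
exists q; split; rewrite ?sq // => l /gl[c sc el]; exists (c * ('X - r%:P)).
  apply: leq_trans (size_polyMleq _ _) _; rewrite size_XsubC addn2 ltnS.
  by apply: leq_trans sc _; rewrite subnSK.
by rewrite el e; ring.
Qed.

Lemma has_factor_le k k' v : (k <= k' <= n)%N -> has_factor a k' v -> has_factor a k v.
Proof.
move=> /andP[]; elim: k' => [|k' IH]; first by rewrite leqn0 => /eqP ->.
rewrite leq_eqVlt => /orP[/eqP -> //|kk'] k'n /(has_factor_pred k'n).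
by apply: IH => //; apply: ltnW.
Qed.

Lemma has_factor_max v : exists mu, [/\ (mu <= n)%N, has_factor a mu v &
  forall k, (mu < k <= n)%N -> ~ has_factor a k v].
Proof.
suff h s : exists mu, [/\ (mu <= minn s n)%N, has_factor a mu v &
    forall k, (mu < k <= minn s n)%N -> ~ has_factor a k v].
  by have := h n; rewrite minnn.
elim: s => [|s [mu [m1 m2 m3]]].
  exists 0%N; split=> [||k]; [by rewrite min0n|exact: has_factor0|].
  by rewrite min0n; lia.
case: (leqP n s) => ns.
  by exists mu; move: m1 m3; rewrite !(minn_idPr _) // leqW.
rewrite (minn_idPl ns); rewrite (minn_idPl (ltnW ns)) in m1 m3.
case: (classic (has_factor a s.+1 v)) => hs.
  by exists s.+1; split=> // k /andP[h1 h2]; move: h2; rewrite leqNgt h1.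
exists mu; split=> //; first exact: leqW.
move=> k /andP[mk]; rewrite leq_eqVlt => /orP[/eqP -> //|ks].
by apply: m3; rewrite mk.
Qed.

Lemma not_constant (v : 'rV[K]_3) : exists t, forall c, point_at t != c *: v.
Proof.
apply: NNPP => no; have [w [w0 Fw wS]] := zeros_infinite [:: v; point_infty].
case: (zero_image w0 Fw) => [[t [c e]]|[c e]]; last first.
  by have /negP[] := wS point_infty c (mem_last v [:: point_infty]); rewrite e.
case: no; exists t => c'; apply/negP => /eqP e'.
by have /negP[] := wS v (c * c') (mem_head _ _); rewrite e e' scalerA.
Qed.

Section Count.
Variables (i j k : 'I_3).
Hypotheses (ij : i != j) (ik : i != k) (jk : j != k).
Variable v : 'rV[K]_3.
Hypothesis vi : v 0 i = 1.

Let X := pullback a ('e_j - v 0 j *: 'e_i).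
Let Y := pullback a ('e_k - v 0 k *: 'e_i).

Lemma delta_dot (l : 'I_3) (w : 'rV[K]_3) : (('e_l : 'rV[K]_3) *m w^T) 0 0 = w 0 l.
Proof. by rewrite -rowE !mxE. Qed.

Lemma mx11B (M N : 'M[K]_1) c : (M - c *: N) 0 0 = M 0 0 - c * N 0 0.
Proof. by rewrite !mxE. Qed.

Lemma X_eval t : X.[t] = xcoord i j v (point_at t).
Proof.
by rewrite pullback_eval mulmxBl -scalemxAl mx11B !delta_dot.
Qed.

Lemma Y_eval t : Y.[t] = ycoord i k v (point_at t).
Proof.
by rewrite pullback_eval mulmxBl -scalemxAl mx11B !delta_dot.
Qed.

(** X and Y are the pullbacks of two linear forms that span those vanishing at v. *)
Lemma factor_of_XY s (g p q : {poly K}) : g != 0 -> (size g <= s.+1)%N ->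
    (size p <= (n - s).+1)%N -> (size q <= (n - s).+1)%N ->
  X = p * g -> Y = q * g -> has_factor a s v.
Proof.
move=> g0 sg sp sq eX eY; exists g; split=> // l lv.
exists (l 0 j *: p + l 0 k *: q).
  apply: leq_trans (size_polyD _ _) _; rewrite geq_max.
  by rewrite !(leq_trans (size_scale_leq _ _)).
rewrite mulrDl -!scalerAl -eX -eY -[l 0 k *: Y]addr0.
rewrite -(_ : pullback a 0 = 0); last by rewrite /pullback mul0mx raddf0.
rewrite -!pullback_lin addr0; congr pullback.
have lvi : l 0 i + l 0 j * v 0 j + l 0 k * v 0 k = 0.
  have := congr1 (fun M : 'M_1 => M 0 0) lv; rewrite !mxE => <-.
  rewrite (bigD1 i) //= (bigD1 j) 1?eq_sym //= (bigD1 k) /=; last by rewrite eq_sym ik eq_sym.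
  rewrite big1 ?addr0 => [|l' /andP[/andP[l1 l2] l3]].
    by rewrite !mxE vi mulr1 addrA.
  by case: (ord3P ij ik jk l') l1 l2 l3 => ->; rewrite eqxx.
have {}lvi : l 0 i = - (l 0 j * v 0 j) - l 0 k * v 0 k.
  by apply/eqP; rewrite -subr_eq0 -lvi; apply/eqP; ring.
apply/rowP => l'; rewrite !mxE eqxx /=.
case: (ord3P ij ik jk l') => ->; rewrite ?lvi ?eqxx ?(negbTE ij) ?(negbTE ik) ?(negbTE jk)
  1?[j == i]eq_sym 1?[k == i]eq_sym 1?[k == j]eq_sym
  ?(negbTE ij) ?(negbTE ik) ?(negbTE jk) /=; ring.
Qed.

Lemma XY_neq0 : ~ (X = 0 /\ Y = 0).
Proof.
case=> X0 Y0; have [t /(_ (point_at t 0 i)) /negP[]] := not_constant v.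
rewrite {1}(coordE ij ik jk vi (point_at t)) -X_eval -Y_eval X0 Y0 !horner0.
by rewrite !scale0r !addr0.
Qed.

(* Both sides count the points of C other than v on a generic line through v:
   n - mu counts their parameters, d - m the roots of the equation. *)
Lemma count_branches m mu : order_at_origin (local_equation F v i) m ->
    (mu <= n)%N -> has_factor a mu v ->
    (forall s, (mu < s <= n)%N -> ~ has_factor a s v) ->
  (n - mu = d - m)%N.
Proof.
move=> om mun [g [g0 sg gl]] mumax.
have dotv (l : 'I_3) : ('e_l - v 0 l *: 'e_i) *m v^T = 0 :> 'M_1.
  by apply/matrixP => i' j'; rewrite !ord1 mulmxBl -scalemxAl mx11B !delta_dot vi mulr1 subrr mxE.
have [p sp eX] := gl _ (dotv j); have [q sq eY] := gl _ (dotv k).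
rewrite -/X in eX; rewrite -/Y in eY; set N := (n - mu)%N in sp sq *.
have pq0 : ~ (p = 0 /\ q = 0).
  by case=> p0 q0; apply: XY_neq0; rewrite eX eY p0 q0 !mul0r.
have succN : (0 < N)%N -> (mu < mu.+1 <= n)%N /\ (n - mu.+1).+1 = N.
  by rewrite /N subn_gt0 => h; rewrite ltnSn h subnSK.
(* A common root of the cofactors would enlarge g to a common factor of degree mu + 1. *)
have no_common r : root p r -> ~~ root q r.
  move=> pr; apply/negP => qr.
  have [p1 ep] := factor_theorem p r pr; have [q1 eq] := factor_theorem q r qr.
  have szM (f f1 : {poly K}) s : f = f1 * ('X - r%:P) -> (size f <= s.+1)%N -> (size f1 <= s)%N.
    move=> ->; have [->|f0] := eqVneq f1 0; first by rewrite size_poly0.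
    by rewrite size_Mmonic ?monicXsubC // size_XsubC addn2 ltnS.
  have sp1 := szM _ _ _ ep sp; have sq1 := szM _ _ _ eq sq.
  have N0 : (0 < N)%N.
    rewrite lt0n; apply/negP => /eqP N0; apply: pq0; move: sp1 sq1.
    by rewrite N0 !leqn0 !size_poly_eq0 ep eq => /eqP -> /eqP ->; rewrite !mul0r.
  have [h1 h2] := succN N0.
  apply: (mumax _ h1); apply: (@factor_of_XY _ (g * ('X - r%:P)) p1 q1); rewrite ?h2 //.
  - by rewrite mulf_neq0 // polyXsubC_eq0.
  - by rewrite size_Mmonic ?monicXsubC // size_XsubC addn2.
  - by rewrite eX ep; ring.
  - by rewrite eY eq; ring.
(* The same at infinity: if both cofactors dropped in size, g itself would count as a factor of
   degree mu + 1. *)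
have top : p`_N = 0 -> q`_N != 0.
  move=> pN; apply/negP => /eqP qN.
  have low (f : {poly K}) : (size f <= N.+1)%N -> f`_N = 0 -> (size f <= N)%N.
    move=> sf fN; apply/leq_sizeP => l; rewrite leq_eqVlt => /orP[/eqP <- //|Nl].
    by rewrite nth_default // (leq_trans sf).
  have sp1 := low _ sp pN; have sq1 := low _ sq qN.
  have N0 : (0 < N)%N.
    rewrite lt0n; apply/negP => /eqP N0; apply: pq0; move: sp1 sq1.
    by rewrite N0 !leqn0 !size_poly_eq0 => /eqP -> /eqP ->.
  have [h1 h2] := succN N0.
  apply: (mumax _ h1); apply: (@factor_of_XY _ g p q); rewrite ?h2 //.
  exact: leq_trans sg _.
(* Away from the zeros of g, the roots of R x are the parameters of the points on the line of slope
   x. *)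
pose R x := q - x *: p.
have rootR x r : root (R x) r = (q.[r] == x * p.[r]).
  by rewrite rootE hornerD hornerN hornerZ subr_eq0.
have quot x r : root (R x) r -> (p.[r] != 0) /\ x = q.[r] / p.[r].
  rewrite rootR => /eqP e; have pr : p.[r] != 0.
    apply/negP => /[dup] pr /eqP pr0; have /negP[] := no_common r pr.
    by rewrite rootE e pr0 mulr0.
  by rewrite e mulfK.
have [b2 b2P] : exists b2 : seq K, forall x, x \notin b2 -> R x != 0 ->
    forall r, root (R x) r -> ~~ root (R x)^`() r.
  pose W := p * q^`() - p^`() * q.
  (* A multiple root r of R x is a zero of W, and it determines x = q(r) / p(r). If W = 0, then R x
     is a nonzero multiple of p, and its roots would be common to p and q. *)
  have [W0|W0] := eqVneq W 0.
    exists [::] => x _ Rx0 r Rr; have [pr _] := quot _ _ Rr.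
    have p0 : p != 0 by apply: contraNneq pr => ->; rewrite horner0.
    have [c ec] := wronskian_eq0 charK p0 (subr0_eq W0).
    have : R x = (c - x) *: p by rewrite /R ec scalerBl.
    move=> eR; have cx : c - x != 0 by apply: contraNneq Rx0 => c0; rewrite eR c0 scale0r.
    by move: Rr; rewrite eR rootZ // rootE (negbTE pr).
  have [rW rWP] := poly_roots_seq W0.
  exists [seq q.[r] / p.[r] | r <- rW] => x xW _ r Rr; have [pr xE] := quot _ _ Rr.
  apply/negP => R'r; move/negP: xW; apply; rewrite xE; apply: map_f.
  move: R'r; rewrite rWP /R derivB derivZ !rootE !hornerE subr_eq0 => /eqP ->.
  by rewrite {1}xE; apply/eqP; field.
have [b3 b3P] := poly_roots_seq g0.
have [b5 b5P] := generic_roots charK ij ik jk vi hF irrF.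
have [md sG] := order_size ij ik jk vi hF irrF om.
have [b4 b4P] : exists b4 : seq K, forall b, b \in point_infty :: B ->
    ycoord i k v b / xcoord i j v b \in b4.
  by exists [seq ycoord i k v b / xcoord i j v b | b <- point_infty :: B] => b; apply: map_f.
(* Excluded are, in order: the slope for which R x drops in degree, those with multiple roots, those
   that meet a zero of g, those of the points of [B] and of [point_infty], and those where F has too
   few roots. *)
have [x] := closed_field_fresh (q`_N / p`_N :: b2 ++ [seq q.[r] / p.[r] | r <- b3]
  ++ b4 ++ b5).
rewrite inE !mem_cat !negb_or => /andP[x1 /andP[x2 /andP[x3 /andP[x4 /b5P[zs [uzs szs zsP]]]]]].
rewrite sG /= in szs.
have RN : (R x)`_N != 0.
  rewrite coefB coefZ subr_eq0; have [pN|pN] := eqVneq (p`_N) 0.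
    by rewrite pN mulr0 top.
  by apply: contra x1 => /eqP ->; rewrite mulfK.
have Rx0 : R x != 0 by apply: contraNneq RN => ->; rewrite coef0.
have sR : size (R x) = N.+1.
  apply/anti_leq/andP; split.
    apply: leq_trans (size_polyD _ _) _; rewrite geq_max sq size_polyN.
    exact: leq_trans (size_scale_leq _ _) sp.
  by rewrite ltnNge; apply: contra RN => /leq_sizeP ->.
have [rs [urs srs rsP]] := simple_roots Rx0 (b2P x x2 Rx0).
rewrite sR /= in srs; rewrite -srs -szs.
(* The coordinate z on the line of slope x of the point with parameter r: the bijection from the
   roots of R x to those of F. *)
pose f r := point_at r 0 i / xcoord i j v (point_at r).
have xE r : xcoord i j v (point_at r) = p.[r] * g.[r] by rewrite -X_eval eX hornerM.
have yE r : ycoord i k v (point_at r) = q.[r] * g.[r] by rewrite -Y_eval eY hornerM.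
have ptE r : r \in rs -> xcoord i j v (point_at r) != 0 /\
    point_at r = xcoord i j v (point_at r) *: line_pt j k v x (f r).
  rewrite rsP => Rr; have [pr xq] := quot _ _ Rr.
  have gr : g.[r] != 0.
    apply: contra x3 => gr; rewrite xq; apply: (map_f (fun r => q.[r] / p.[r])).
    by rewrite b3P rootE.
  have xn0 : xcoord i j v (point_at r) != 0 by rewrite xE mulf_neq0.
  split=> //; rewrite {1}(line_ptE ij ik jk vi xn0); congr (_ *: line_pt _ _ _ _ _).
  by rewrite xE yE xq; field; rewrite pr.
have notB r c b : r \in rs -> b \in point_infty :: B -> point_at r != c *: b.
  move=> rrs bB; apply: contra x4 => /eqP e; have [xn0 e'] := ptE _ rrs.
  suff -> : x = ycoord i k v b / xcoord i j v b by apply: b4P.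
  apply: (@line_pt_scaled i j k v b x (f r) (c / xcoord i j v (point_at r))) => //.
  by rewrite mulrC -scalerA -e {2}e' scalerA mulVf // scale1r.
have injf : {in rs &, injective f}.
  move=> r r' rrs rrs' ff; have [xn0 e] := ptE _ rrs; have [xn0' e'] := ptE _ rrs'.
  have : point_at r = (xcoord i j v (point_at r) / xcoord i j v (point_at r')) *: point_at r'.
    by rewrite {1}e ff [X in _ = _ *: X]e' scalerA divfK.
  case/gen_inj => // -[b bB [c eb]].
  have bB' : b \in point_infty :: B by rewrite inE bB orbT.
  by have /eqP := notB r c b rrs bB'.
have sub1 : {subset map f rs <= zs}.
  move=> _ /mapP[r rrs ->]; rewrite zsP; have [xn0 e] := ptE _ rrs.
  by rewrite -(homog_scale_eq0 _ xn0) -e image_zero.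
have sub2 : {subset zs <= map f rs}.
  move=> z; rewrite zsP => /eqP Fz.
  case: (zero_image (line_pt_neq0 x z ij ik jk vi) Fz) => [[t [c e]]|[c e]]; last first.
    move/negP: x4; case; rewrite (line_pt_scaled ij ik jk vi e).
    by apply: b4P; apply: mem_head.
  have ex := xcoord_line_pt ij ik jk vi x z; have ey := ycoord_line_pt ij ik jk vi x z.
  have ez := zeta_line_pt ij ik vi x z.
  rewrite e xcoordZ in ex; rewrite e ycoordZ in ey; rewrite e mxE in ez.
  have xn0 : xcoord i j v (point_at t) != 0.
    by apply: contra_eq_neq ex => ->; rewrite mulr0 eq_sym oner_eq0.
  apply/mapP; exists t.
    rewrite rsP rootR; have : p.[t] * g.[t] != 0 by rewrite -xE.
    rewrite mulf_eq0 negb_or => /andP[pt gt]; apply/eqP/(mulIf gt).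
    by rewrite -yE -mulrA -xE -ey mulrAC ex mul1r.
  by apply: (mulIf xn0); rewrite /f divfK // -ez mulrAC ex mul1r.
apply/eqP; rewrite eqn_leq -(size_map f rs); apply/andP; split; last exact: uniq_leq_size.
by apply: uniq_leq_size; rewrite ?map_inj_in_uniq.
Qed.

(** The cofactors of a factor of degree n are constants, so X and Y are proportional to g; this is a
    linear relation between the f_u. *)
Lemma full_factor_degenerate : has_factor a n v ->
  exists2 l : 'rV[K]_3, l != 0 & l *m a = 0.
Proof.
case=> g [g0 sg gl].
have dotv (l : 'I_3) : ('e_l - v 0 l *: 'e_i) *m v^T = 0 :> 'M_1.
  by apply/matrixP => i' j'; rewrite !ord1 mulmxBl -scalemxAl mx11B !delta_dot vi mulr1 subrr mxE.
have [p sp eX] := gl _ (dotv j); have [q sq eY] := gl _ (dotv k).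
rewrite -/X in eX; rewrite -/Y in eY; rewrite subnn in sp sq.
rewrite (size1_polyC sp) in eX; rewrite (size1_polyC sq) in eY.
exists (q`_0 *: ('e_j - v 0 j *: 'e_i) + - p`_0 *: ('e_k - v 0 k *: 'e_i)); last first.
  apply: (@rVpoly_inj K); rewrite raddf0 -/(pullback a _) pullback_lin -/X.
  rewrite -[_ *: ('e_k - _)]addr0 pullback_lin -/Y.
  rewrite (_ : pullback a 0 = 0); last by rewrite /pullback mul0mx raddf0.
  rewrite eX eY addr0 -!mul_polyC polyCN; ring.
apply/negP => /eqP/rowP l0.
have q0 : q`_0 = 0.
  move: (l0 j); rewrite !mxE !eqxx (negbTE jk) eq_sym (negbTE ij) /= => e; apply: etrans e; ring.
have p0 : p`_0 = 0.
  move: (l0 k); rewrite !mxE !eqxx [k == j]eq_sym (negbTE jk) [k == i]eq_sym (negbTE ik) q0 /=.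
  by move=> e; apply/eqP; rewrite -oppr_eq0; apply/eqP; apply: etrans e; ring.
by apply: XY_neq0; rewrite eX eY p0 q0 !mul0r.
Qed.
End Count.

Hypothesis image_zero_infty : F.@[point_infty 0] = 0.
Hypothesis n_ge3 : (3 <= n)%N.

Lemma has_factor1_zero v : v != 0 -> has_factor a 1 v -> F.@[v 0] = 0.
Proof.
move=> v0 [g gv]; have [g0 sg _] := gv.
have [c c0 e] : exists2 c, c != 0 & F.@[(c *: v) 0] = 0.
  case: (eqVneq (size g) 1%N) => [s1|/closed_rootP[t gt]].
    have [||c c0 e] := common_factor_infty _ v0 gv; rewrite ?s1 //.
      by rewrite (leq_trans _ n_ge3).
    by exists c => //; rewrite -e.
  have [c c0 e] := common_factor_root v0 gv gt.
  by exists c => //; rewrite -e image_zero.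
by apply/eqP; rewrite -(homog_scale_eq0 _ c0) e.
Qed.

(** At a point off C both m and mu are 0, and the count of branches reads n = d. *)
Lemma degree_eq : d = n.
Proof.
have [i [v [vi Fv]]] := off_curve; have [j [k [ij ik jk]]] := ord3_others i.
have [m om] := order_exists ij ik jk vi hF irrF.
have [mu [mun hmu mumax]] := has_factor_max v.
have mu0 : mu = 0%N.
  case: (posnP mu) => // mu0; move/eqP: Fv; case; apply: has_factor1_zero.
    by apply/rV0Pn; exists i; rewrite vi oner_eq0.
  by apply: has_factor_le hmu; rewrite mu0.
have := count_branches ij ik jk vi om mun hmu mumax.
by rewrite (off_curve_order Fv om) mu0 !subn0.
Qed.

Lemma pullback_sum (l : 'rV[K]_3) :
  pullback a l = \sum_u l 0 u *: pullback a 'e_u.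
Proof.
rewrite {1}[l]row_sum_delta /pullback mulmx_suml raddf_sum /=; apply: eq_bigr => u _.
by rewrite -scalemxAl linearZ.
Qed.

Lemma point_at_pullback t u : point_at t 0 u = (pullback a 'e_u).[t].
Proof. by rewrite pullback_eval delta_dot. Qed.

(** At a double root t of the common factor, the parameterization and its derivative are both
    multiples of v, hence proportional. *)
Lemma double_root_wronskian (v : 'rV[K]_3) g t u u' : v != 0 ->
    common_factor a 2 v (g * ('X - t%:P) * ('X - t%:P)) ->
  root (pullback a 'e_u * (pullback a 'e_u')^`() -
        (pullback a 'e_u)^`() * pullback a 'e_u') t.
Proof.
move=> v0 gv; have gt : root (g * ('X - t%:P) * ('X - t%:P)) t.
  by rewrite rootM root_XsubC eqxx orbT.
have [c _ e] := common_factor_root v0 gv gt.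
pose D : 'rV[K]_3 := \row_u (pullback a 'e_u)^`().[t].
have [c' e'] : exists c', D^T = c' *: v^T.
  apply: perp_scalar => // l lv; have [_ _ /(_ l lv)[h _ eh]] := gv.
  apply/matrixP => i' j'; rewrite !ord1 [RHS]mxE.
  transitivity (pullback a l)^`().[t].
    rewrite pullback_sum (raddf_sum (@deriv K)) horner_sum mxE; apply: eq_bigr => w _.
    by rewrite /= derivZ hornerZ !mxE.
  by rewrite eh !derivM derivXsubC !(hornerD, hornerM, hornerN, hornerX, hornerC) subrr; ring.
have DE w : (pullback a 'e_w)^`().[t] = c' * v 0 w.
  by have := congr1 (fun M : 'cV_3 => M w 0) e'; rewrite !mxE.
have PE w : (pullback a 'e_w).[t] = c * v 0 w by rewrite -point_at_pullback e mxE.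
rewrite rootE hornerD hornerN !hornerM !DE !PE; apply/eqP; ring.
Qed.

(** Otherwise all f_u would be multiples of one of them, and the parameterization would be
    constant. *)
Lemma wronskian_exists : exists u u', pullback a 'e_u * (pullback a 'e_u')^`() -
  (pullback a 'e_u)^`() * pullback a 'e_u' != 0.
Proof.
apply: NNPP => no.
have [u fu] : exists u, pullback a 'e_u != 0.
  have /rV0Pn[u pu] := point_at_neq0 0; exists u.
  by apply: contraNneq pu => fu; rewrite point_at_pullback fu horner0.
have /fin_all_exists[c cP] u' : exists c, pullback a 'e_u' = c *: pullback a 'e_u.
  apply: (wronskian_eq0 charK fu); apply/eqP; rewrite -subr_eq0.
  by apply/negPn/negP => W; case: no; exists u, u'.
have [t /(_ (pullback a 'e_u).[t])/negP[]] := not_constant (\row_u' c u').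
by apply/eqP/rowP => u'; rewrite point_at_pullback cP hornerZ !mxE mulrC.
Qed.

(* A double factor comes from two parameters with the same image, or from a
   parameter where the Wronskians of the parameterization vanish. *)
Lemma finite_double : exists S : seq 'rV[K]_3, forall v, v != 0 ->
  has_factor a 2 v -> exists2 b, b \in S & exists c, v = c *: b.
Proof.
have [u [u' W0]] := wronskian_exists; have [rW rWP] := poly_roots_seq W0.
exists (point_infty :: B ++ map point_at rW) => v v0 [g gv].
have inv c b : c != 0 -> b = c *: v -> exists c', v = c' *: b.
  by move=> c0 ->; exists c^-1; rewrite scalerA mulVf // scale1r.
(* Size at most 2 means that one of the two zeros is at infinity, so v is the point of parameter
   (0:1). *)
have [g0 sg _] := gv; case: (leqP (size g) 2) => sg2.
  have [|c c0 e] := common_factor_infty _ v0 gv sg2; first exact: ltnW n_ge3.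
  by exists point_infty; [exact: mem_head|exact: inv e].
have {}sg : size g = 3 by apply/anti_leq; rewrite sg.
have /closed_rootP[r gr] : size g != 1%N by rewrite sg.
have [q eq] := factor_theorem g r gr.
have q0 : q != 0 by apply: contraNneq g0 => q0; rewrite eq q0 mul0r.
have sq : size q = 2 by move: sg; rewrite eq size_Mmonic ?monicXsubC // size_XsubC addn2 => -[].
have /closed_rootP[r' qr'] : size q != 1%N by rewrite sq.
have gr' : root g r' by rewrite eq rootM qr'.
have [c c0 e] := common_factor_root v0 gv gr.
have [c' c0' e'] := common_factor_root v0 gv gr'.
have : point_at r = (c / c') *: point_at r' by rewrite e e' scalerA divfK.
case/gen_inj => [rr|[b bB [c2 eb]]]; last first.
  exists b; first by rewrite inE mem_cat bB orbT.
  by exists (c^-1 * c2); rewrite -scalerA -eb e scalerA mulVf // scale1r.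
exists (point_at r); last exact: inv e.
rewrite inE mem_cat; apply/orP; right; apply/orP; right; apply: map_f.
rewrite rWP; have [h eh] := factor_theorem q r' qr'.
by apply: (double_root_wronskian (g := h) _ _ v0); rewrite {1}rr -eh -eq.
Qed.

(** l0 is the equation of a line containing C. It passes through w and pulls back to 0, so the lines
    through w pull back to the multiples of a single h. *)
Lemma degenerate_full_factor (l0 w : 'rV[K]_3) : l0 != 0 -> l0 *m a = 0 ->
  w != 0 -> F.@[w 0] = 0 -> has_factor a n w.
Proof.
move=> l00 l0a w0 Fw.
have l0w : l0 *m w^T = 0.
  by case: (zero_image w0 Fw) => [[t [c ->]]|[c ->]];
    rewrite linearZ /= trmxK -scalemxAr mulmxA l0a mul0mx scaler0.
pose Kw := kermx w^T; pose M := Kw *m a.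
have rKw : \rank Kw = 2 by rewrite mxrank_ker mxrank_tr rank_rV w0.
have rM : (\rank M <= 1)%N.
  have := mxrank_mul_ker Kw a; rewrite -/M rKw => e.
  have : (0 < \rank (Kw :&: kermx a))%N.
    rewrite lt0n mxrank_eq0; apply: contra l00 => /eqP c0.
    by rewrite -submx0 -c0 sub_capmx; apply/andP; split; apply/sub_kermxP.
  lia.
pose h := nz_row M.
have Mh : (M <= h)%MS.
  have hM : (h <= M)%MS by apply: nz_row_sub.
  have [M0|M0] := eqVneq M 0; first by rewrite M0 sub0mx.
  by rewrite -(geq_leqif (mxrank_leqif_sup hM)) rank_rV nz_row_eq0 M0.
(* If h = 0 all these pullbacks vanish, and 1 serves as a nonzero factor. *)
exists (if h == 0 then 1 else rVpoly h); split.
- by case: (h =P 0) => [_|/eqP h0]; rewrite ?oner_eq0 // rVpoly_eq0.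
- by case: (h =P 0) => _; rewrite ?size_poly1 ?size_rVpoly.
move=> l lw; have : (l *m a <= h)%MS.
  by apply: submx_trans Mh; apply: submxMr; apply/sub_kermxP.
case/sub_rVP=> c e; rewrite subnn /pullback e linearZ /=.
case: (h =P 0) => [->|_]; first by exists 0; rewrite ?size_poly0 // raddf0 scaler0 mul0r.
by exists c%:P; rewrite ?size_polyC_leq1 // mul_polyC.
Qed.

(* A factor of degree n means that C lies on a line; every point of C would then
   have a factor of degree n. *)
Lemma no_full_factor i (v : 'rV[K]_3) : v 0 i = 1 -> ~ has_factor a n v.
Proof.
move=> vi; have [j [k [ij ik jk]]] := ord3_others i.
case/(full_factor_degenerate ij ik jk vi) => l l0 la.
have [S SP] := finite_double; have [w [w0 Fw wS]] := zeros_infinite S.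
have [|b bS [c e]] := SP w w0.
  by apply: (@has_factor_le 2 n); [rewrite leqnn andbT ltnW|exact: degenerate_full_factor la w0 Fw].
by have /negP[] := wS b c bS; rewrite e.
Qed.

(** With d = n, the count n - mu = d - m identifies the order m with the largest degree mu of a
    common factor. *)
Theorem order_factor i (v : 'rV[K]_3) m : v 0 i = 1 ->
    order_at_origin (local_equation F v i) m ->
  (m < n)%N /\ forall k, (k <= n)%N -> has_factor a k v <-> (k <= m)%N.
Proof.
move=> vi om; have [j [k0 [ij ik jk]]] := ord3_others i.
have [mu [mun hmu mumax]] := has_factor_max v.
have := count_branches ij ik jk vi om mun hmu mumax.
have [] := order_size ij ik jk vi hF irrF om; rewrite degree_eq => mn _ e.
have {}e : m = mu by lia.
rewrite {}e in om mn *; split.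
  rewrite ltn_neqAle mn andbT; apply/eqP => e; rewrite e in hmu.
  exact: (no_full_factor vi hmu).
move=> k kn; split=> [hk|km].
  by rewrite leqNgt; apply/negP => muk; apply: (mumax k) => //; rewrite muk.
by apply: has_factor_le hmu; rewrite km.
Qed.
End Curve.

(** * Finite sets of points *)

Section ProjectiveSpace.
Variables (K : closedFieldType) (m : nat).
Implicit Types (P Q : pspace K m) (p q : {mpoly K[m.+1]}).

Definition rep_vec P : 'rV[K]_m.+1 := vpick (val P).

Lemma rep_vec_neq0 P : rep_vec P != 0.
Proof. by rewrite vpick0 -dimv_eq0 (eqP (valP P)). Qed.

Lemma pspaceE P : val P = <[rep_vec P]>%VS.
Proof.
apply/eqP; rewrite eq_sym eqEdim -memvE memv_pick dim_vline rep_vec_neq0.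
by rewrite (eqP (valP P)).
Qed.

Lemma pspace_of (v : 'rV[K]_m.+1) : v != 0 -> exists P, val P = <[v]>%VS.
Proof.
move=> v0; have dv : \dim <[v]>%VS == 1%N by rewrite dim_vline v0.
by exists (exist (fun U => \dim U == 1%N) _ dv).
Qed.

Lemma mem_pspace P v : reflect (exists c, v = c *: rep_vec P) (v \in val P).
Proof. by rewrite pspaceE; apply: vlineP. Qed.

Lemma line_eqP (u v : 'rV[K]_m.+1) : u != 0 ->
  <[u]>%VS = <[v]>%VS -> exists2 c, c != 0 & u = c *: v.
Proof.
move=> u0 e; have /vlineP[c uc] : u \in <[v]>%VS by rewrite -e memv_line.
by exists c => //; apply: contraNneq u0 => c0; rewrite uc c0 scale0r.
Qed.

Lemma line_scale (v : 'rV[K]_m.+1) c : c != 0 -> <[c *: v]>%VS = <[v]>%VS.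
Proof.
move=> c0; apply/eqP; rewrite eqEsubv -!memvE; apply/andP; split.
  by apply: memvZ; apply: memv_line.
by apply/vlineP; exists c^-1; rewrite scalerA mulVf // scale1r.
Qed.

Lemma rep_vec_line P v : v != 0 -> val P = <[v]>%VS -> exists2 c, c != 0 & rep_vec P = c *: v.
Proof.
by move=> v0 e; apply: line_eqP; rewrite ?rep_vec_neq0 // -pspaceE.
Qed.

Lemma mem_pspace_neq0 P v : v \in val P -> v != 0 -> val P = <[v]>%VS.
Proof.
move=> /mem_pspace[c ->] cv; rewrite pspaceE line_scale //.
by apply: contraNneq cv => ->; rewrite scale0r.
Qed.

Lemma vanishes_homog d p P v : p \is d.-homog -> v != 0 -> val P = <[v]>%VS ->
  vanishes_at p P <-> p.@[v 0] = 0.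
Proof.
move=> hp v0 Pv; split=> [|pv w]; first by apply; rewrite Pv memv_line.
by rewrite Pv => /vlineP[c ->]; rewrite (dhomog_scale _ _ hp) pv mulr0.
Qed.

(** On the line, p is a polynomial f in the scalar c. All values of X f are 0, so f = 0 and p
    vanishes at the origin too. *)
Lemma vanishes_punctured p P :
  (forall c, c != 0 -> p.@[(c *: rep_vec P) 0] = 0) -> vanishes_at p P.
Proof.
move=> h; pose f := \poly_(t < msize p) (pihomog mdeg t p).@[rep_vec P 0].
have fE c : f.[c] = p.@[(c *: rep_vec P) 0].
  by rewrite (homog_parts_scale _ _ (leqnn _)) horner_poly.
have f0 : 'X * f = 0.
  apply: poly_eq_eval => c; rewrite hornerM hornerX horner0 fE.
  by have [->|/h ->] := eqVneq c 0; rewrite ?mul0r ?mulr0.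
move=> _ /mem_pspace[c ->]; rewrite -fE.
by move/eqP: f0; rewrite mulf_eq0 polyX_eq0 => /eqP ->; rewrite horner0.
Qed.

(** On the line of P, the values of the homogeneous parts of p are the coefficients of a polynomial
    in the scalar, which vanishes identically. *)
Lemma vanishes_pihomog p P t : vanishes_at p P -> vanishes_at (pihomog mdeg t p) P.
Proof.
move=> pP; apply/(vanishes_homog (pihomogP _ _ _) (rep_vec_neq0 P) (pspaceE P)).
pose N := maxn t.+1 (msize p).
have : \poly_(s < N) (pihomog mdeg s p).@[rep_vec P 0] = 0.
  apply: poly_eq_eval => c; rewrite horner0 horner_poly.
  rewrite -(homog_parts_scale _ _ (leq_maxr t.+1 _)); apply: pP.
  by apply/mem_pspace; exists c.
move/(congr1 (fun f : {poly K} => f`_t)); rewrite coef_poly coef0.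
by rewrite leq_max ltnSn.
Qed.

Lemma vanishing_idealP (S : pspace K m -> Prop) p :
  vanishing_ideal S p <-> forall P, S P -> vanishes_at p P.
Proof.
split=> [|pS].
  apply: (@ideal_gen_sub _ _ (fun p => forall P, S P -> vanishes_at p P)) => [|q [_ qS]] //.
  split=> [P _ v _|x y xS yS P SP v vP|x y yS P SP v vP]; first by rewrite meval0.
    by rewrite mevalD (xS P) // (yS P) // addr0.
  by rewrite mevalM (yS P) // mulr0.
rewrite {1}(pihomog_partitionE (mf := mdeg) (leqnn (msize p))).
apply: ideal_sum => [|t _ _]; first exact: ideal_gen_ideal.
apply: mem_ideal_gen; split; first by exists t; apply: pihomogP.
by move=> P SP; apply: vanishes_pihomog; apply: pS.
Qed.

Definition linear_form (l : 'rV[K]_m.+1) : {mpoly K[m.+1]} := \sum_i l 0 i *: 'X_i.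

Lemma linear_form_homog l : linear_form l \is 1.-homog.
Proof. by apply: rpred_sum => i _; apply: rpredZ; rewrite dhomogX; apply/eqP/mdeg1. Qed.

Lemma linear_form_eval l (v : 'rV[K]_m.+1) : (linear_form l).@[v 0] = (l *m v^T) 0 0.
Proof.
rewrite meval_sum mxE; apply: eq_bigr => i _.
by rewrite mevalZ mevalXU mxE.
Qed.

Lemma linear_form_nonzero P : exists l, l.@[rep_vec P 0] != 0 /\ l \is 1.-homog.
Proof.
have /rV0Pn[i Pi] := rep_vec_neq0 P; exists 'X_i; rewrite mevalXU; split=> //.
by rewrite dhomogX; apply/eqP/mdeg1.
Qed.

Lemma linear_form_separates P Q : P != Q ->
  exists l, [/\ l.@[rep_vec P 0] != 0, l.@[rep_vec Q 0] = 0 & l \is 1.-homog].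
Proof.
move=> PQ; apply: NNPP => no.
have PE : (rep_vec P <= rep_vec Q)%MS.
  rewrite submxE; apply/eqP/trmx_inj; rewrite trmx_mul trmx0.
  apply/row_matrixP => i; rewrite row_mul row0; set l := row i _.
  apply/matrixP => i' j'; rewrite !ord1 [RHS]mxE -linear_form_eval.
  apply/eqP/negPn/negP => lP; apply: no; exists (linear_form l); split=> //.
    rewrite linear_form_eval /l -row_mul -trmx_mul mulmx_coker trmx0.
    by rewrite row0 mxE.
  exact: linear_form_homog.
move/sub_rVP: PE => [c e]; case/negP: PQ; apply/eqP/val_inj.
rewrite (pspaceE P) (pspaceE Q) e line_scale //.
by apply: contraNneq (rep_vec_neq0 P) => c0; rewrite e c0 scale0r.
Qed.

Lemma prod_homog N (f : 'I_N -> {mpoly K[m.+1]}) :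
  (forall i, f i \is 1.-homog) -> \prod_i f i \is N.-homog.
Proof.
elim: N f => [|N IH] f fh; first by rewrite big_ord0 dhomog1.
by rewrite big_ord_recl; apply: (dhomogM (d := 1%N)) => //; apply: IH => i.
Qed.

(** A product of linear forms, one for each member of s, all nonzero at P and vanishing at the
    members other than P; it is padded to degree d by a linear form nonzero at P. *)
Lemma separating_form (s : seq (pspace K m)) P d : (size s <= d)%N ->
  exists b, [/\ b \is d.-homog, b.@[rep_vec P 0] = 1 &
    forall Q, Q \in s -> Q != P -> b.@[rep_vec Q 0] = 0].
Proof.
move=> sd; have [l0 [l0P hl0]] := linear_form_nonzero P.
have /fin_all_exists [f fP] (i : 'I_(size s)) : exists l, [/\ l.@[rep_vec P 0] != 0,
    tnth (in_tuple s) i != P -> l.@[rep_vec (tnth (in_tuple s) i) 0] = 0 & l \is 1.-homog].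
  have [->|QP] := eqVneq (tnth (in_tuple s) i) P; first by exists l0.
  rewrite eq_sym in QP.
  by have [l [h1 h2 h3]] := linear_form_separates QP; exists l.
pose b := (\prod_i f i) * l0 ^+ (d - size s).
have hb : b \is d.-homog.
  rewrite -(subnKC sd); apply: dhomogM.
    by apply: prod_homog => i; case: (fP i).
  by have := dhomogMn (d - size s) hl0; rewrite mul1n.
have bP : b.@[rep_vec P 0] != 0.
  rewrite mevalM rmorphXn /= mulf_neq0 ?expf_neq0 // rmorph_prod /=.
  by apply/prodf_neq0 => i _; case: (fP i).
exists ((b.@[rep_vec P 0])^-1 *: b); split; first exact: rpredZ.
  by rewrite mevalZ mulVf.
move=> Q /(tnthP (in_tuple s))[i ->] QP; rewrite mevalZ.
apply/eqP; rewrite mulf_eq0; apply/orP; right; rewrite mevalM rmorph_prod /= (bigD1 i) //=.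
by case: (fP i) => _ /(_ QP) -> _; rewrite !mul0r.
Qed.

(** In degree at least [size s], the separating forms are dual to the evaluations at the points, so
    the coordinates of a form modulo I are its values. *)
Lemma hilbert_poly_points (s : seq (pspace K m)) (I : {mpoly K[m.+1]} -> Prop) :
    uniq s -> (forall p, I p <-> forall P, P \in s -> vanishes_at p P) ->
  hilbert_poly I ((size s)%:R)%:P.
Proof.
move=> us IP; exists (size s) => d sd; exists (size s); last by rewrite hornerC.
have /fin_all_exists [b bP] (i : 'I_(size s)) : exists b, [/\ b \is d.-homog,
    b.@[rep_vec (tnth (in_tuple s) i) 0] = 1 &
    forall Q, Q \in s -> Q != tnth (in_tuple s) i -> b.@[rep_vec Q 0] = 0].
  exact: separating_form.
exists b => [i|p hp]; first by case: (bP i).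
have bE i j : (b i).@[rep_vec (tnth (in_tuple s) j) 0] = (i == j)%:R.
  case: (bP i) => _ b1 b0; have [<-//|ij] := eqVneq i j.
  apply: b0; first exact: mem_tnth.
  by rewrite (inj_eq (elimT (tuple_uniqP (in_tuple s)) us)) eq_sym.
have key c : I (p - \sum_(i < size s) c 0 i *: b i) <->
    forall j, p.@[rep_vec (tnth (in_tuple s) j) 0] = c 0 j.
  have hpc : p - \sum_(i < size s) c 0 i *: b i \is d.-homog.
    by apply: rpredB => //; apply: rpred_sum => i _; apply: rpredZ; case: (bP i).
  have ev j : (p - \sum_(i < size s) c 0 i *: b i).@[rep_vec (tnth (in_tuple s) j) 0] =
      p.@[rep_vec (tnth (in_tuple s) j) 0] - c 0 j.
    rewrite mevalB meval_sum (bigD1 j) //= mevalZ bE eqxx mulr1 big1 ?addr0 // => i ij.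
    by rewrite mevalZ bE (negbTE ij) mulr0.
  split=> [/IP h j|h].
    apply/eqP; rewrite -subr_eq0 -ev; apply/eqP.
    by apply/(vanishes_homog hpc (rep_vec_neq0 _) (pspaceE _)); apply: h; apply: mem_tnth.
  apply/IP => P /(tnthP (in_tuple s))[j ->]; apply/(vanishes_homog hpc (rep_vec_neq0 _) (pspaceE _)).
  by rewrite ev h subrr.
exists (\row_j p.@[rep_vec (tnth (in_tuple s) j) 0]); split.
  by apply/key => j; rewrite mxE.
by move=> c /key h; apply/rowP => j; rewrite mxE h.
Qed.

Lemma finite_subset (S : pspace K m -> Prop) (l : seq (pspace K m)) :
  (forall P, S P -> P \in l) -> exists2 s, uniq s & forall P, P \in s <-> S P.
Proof.
move=> Sl; suff [s sP] : exists s : seq (pspace K m), forall P, P \in s <-> S P /\ P \in l.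
  exists (undup s) => [|P]; first exact: undup_uniq.
  by rewrite mem_undup sP; split=> [[]|SP] //; split=> //; apply: Sl.
elim: l {Sl} => [|Q l [s sP]]; first by exists [::] => P; split=> [//|[]].
case: (classic (S Q)) => SQ.
  exists (Q :: s) => P; rewrite !inE; split.
    by case/orP => [/eqP ->|/sP[SP ->]]; rewrite ?eqxx ?orbT.
  by case=> SP /orP[->//|Pl]; apply/orP; right; apply/sP.
exists s => P; rewrite inE; split=> [/sP[SP ->]|[SP /orP[/eqP PQ|Pl]]]; rewrite ?orbT //.
  by case: SQ; rewrite -PQ.
by apply/sP.
Qed.
End ProjectiveSpace.

Lemma deriv_homog (K : closedFieldType) m d (p : {mpoly K[m]}) l :
  p \is d.-homog -> p^`M(l) \is d.-1.-homog.
Proof.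
move=> hp; apply/dhomogP => e; rewrite mcoeff_msupp mcoeff_deriv => pe.
have : p@_(e + U_(l)) != 0 by apply: contraNneq pe => ->; rewrite mul0rn.
rewrite -mcoeff_msupp => /(dhomog_mf hp) /=; rewrite mdegD mdeg1 addn1 => <-.
by [].
Qed.

(** * Proper parameterizations *)

Section Parameterized.
Variable K : closedFieldType.
Hypothesis charK : [pchar K] =i pred0.
Variables (n : nat) (F : {mpoly K[3]}) (a : 'M[K]_(3, n.+1)) (d : nat).
Hypotheses (n_ge3 : (3 <= n)%N) (hF : F \is d.-homog) (irrF : irreducible_elt F).
Hypothesis f_proper : proper_param a F.

Definition st (s t : K) : 'rV[K]_2 := \row_j (if j == 0 then s else t).

Lemma stE (w : 'rV[K]_2) : w = st (w 0 0) (w 0 1).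
Proof. by apply/rowP => j; rewrite mxE; case: j => -[|[|//]] h; congr (w 0 _); apply: val_inj. Qed.

Lemma param_form_eval u s t :
  (param_form a u).@[st s t 0] = \sum_(j < n.+1) a u j * (s ^+ (n - j) * t ^+ j).
Proof.
rewrite meval_sum; apply: eq_bigr => j _.
by rewrite mevalZ mevalM !rmorphXn /= !mevalXU !mxE.
Qed.

Lemma param_vec_finite s t : param_vec a (st s (s * t)) = s ^+ n *: point_at a t.
Proof.
apply/rowP => u; rewrite mxE param_form_eval !mxE mulr_sumr; apply: eq_bigr => j _.
have e : s ^+ n = s ^+ (n - j) * s ^+ j by rewrite -exprD subnK // -ltnS.
by rewrite !mxE exprMn e; ring.
Qed.

Lemma param_vec_infty t : param_vec a (st 0 t) = t ^+ n *: point_infty a.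
Proof.
apply/rowP => u; rewrite mxE param_form_eval (bigD1 ord_max) //= subnn expr0 mul1r.
rewrite big1 ?addr0; last first.
  move=> j jn; rewrite expr0n subn_eq0 leqNgt.
  have -> : (j < n)%N by rewrite ltn_neqAle -ltnS ltn_ord andbT; apply: contra jn => /eqP e; apply/eqP/val_inj.
  by rewrite mul0r mulr0.
rewrite !mxE (bigD1 ord_max) //= !mxE eqxx mulr1 big1 ?addr0 1?mulrC // => j jn.
by rewrite !mxE (negbTE jn) mulr0.
Qed.

Lemma st_neq0_l t : st 1 t != 0.
Proof. by apply/rV0Pn; exists 0; rewrite mxE oner_eq0. Qed.

Lemma st_neq0_r : st 0 1 != 0.
Proof. by apply/rV0Pn; exists 1; rewrite mxE oner_eq0. Qed.

Lemma stZ c s t : c *: st s t = st (c * s) (c * t).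
Proof. by apply/rowP => j; rewrite !mxE; case: ifP. Qed.

Lemma param_image_finite (Q : pspace K 1) P t : val Q = <[st 1 t]>%VS ->
  param_image a Q P <-> val P = <[point_at a t]>%VS.
Proof.
move=> Qt; have [c c0 e] := rep_vec_line (st_neq0_l t) Qt.
rewrite /param_image -/(rep_vec Q) e stZ mulr1 param_vec_finite line_scale ?expf_neq0 //.
Qed.

Lemma param_image_infty (Q : pspace K 1) P : val Q = <[st 0 1]>%VS ->
  param_image a Q P <-> val P = <[point_infty a]>%VS.
Proof.
move=> Qt; have [c c0 e] := rep_vec_line st_neq0_r Qt.
by rewrite /param_image -/(rep_vec Q) e stZ mulr0 mulr1 param_vec_infty line_scale ?expf_neq0.
Qed.

Lemma no_common_zero (w : 'rV[K]_2) : w != 0 -> param_vec a w != 0.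
Proof.
move=> w0; have [nb _ _] := f_proper; have [Q Qw] := pspace_of w0.
apply/negP => /eqP fw; apply: (nb Q) => u v; rewrite Qw => /vlineP[c ->].
rewrite (@dhomog_scale _ _ n).
  by move/rowP: fw => /(_ u); rewrite !mxE => ->; rewrite mulr0.
apply: rpred_sum => j _; apply: rpredZ.
have X1 (i : 'I_2) : ('X_i : {mpoly K[2]}) \is 1.-homog.
  by rewrite dhomogX; apply/eqP/mdeg1.
have := dhomogM (dhomogMn (n - j) (X1 0)) (dhomogMn j (X1 1)).
by rewrite !mul1n subnK // -ltnS.
Qed.

Lemma param_base_free t : a *m moment n t != 0.
Proof.
have := no_common_zero (st_neq0_l t); rewrite -[t in st _ t]mul1r param_vec_finite.
by rewrite expr1n scale1r trmx_eq0.
Qed.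

Lemma param_base_free_infty : a *m moment_infty K n != 0.
Proof.
have := no_common_zero st_neq0_r; rewrite param_vec_infty.
by rewrite expr1n scale1r trmx_eq0.
Qed.

Lemma param_image_zero t : F.@[point_at a t 0] = 0.
Proof.
have [_ im _] := f_proper; have [Q Qt] := pspace_of (st_neq0_l t).
have p0 : point_at a t != 0 by rewrite trmx_eq0 param_base_free.
have [P Pt] := pspace_of p0.
apply/(vanishes_homog hF p0 Pt)/im; exists Q.
by apply/(param_image_finite _ Qt).
Qed.

Lemma param_image_zero_infty : F.@[point_infty a 0] = 0.
Proof.
have [_ im _] := f_proper; have [Q Qt] := pspace_of st_neq0_r.
have p0 : point_infty a != 0 by rewrite trmx_eq0 param_base_free_infty.
have [P Pt] := pspace_of p0.
apply/(vanishes_homog hF p0 Pt)/im; exists Q.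
by apply/(param_image_infty _ Qt).
Qed.

Lemma param_zero_image (w : 'rV[K]_3) : w != 0 -> F.@[w 0] = 0 ->
  (exists t c, w = c *: point_at a t) \/ (exists c, w = c *: point_infty a).
Proof.
move=> w0 Fw; have [_ im _] := f_proper; have [P Pw] := pspace_of w0.
have /im[Q] := proj2 (vanishes_homog hF w0 Pw) Fw.
rewrite /param_image -/(rep_vec Q) Pw => /(line_eqP w0)[c _ ->].
rewrite [rep_vec Q]stE; have [->|s0] := eqVneq (rep_vec Q 0 0) 0.
  by right; exists (c * (rep_vec Q 0 1) ^+ n); rewrite param_vec_infty scalerA.
left; exists (rep_vec Q 0 1 / rep_vec Q 0 0), (c * (rep_vec Q 0 0) ^+ n).
by rewrite -[rep_vec Q 0 1 in LHS](divfK s0) [_ * rep_vec Q 0 0 in LHS]mulrC param_vec_finite scalerA.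
Qed.

Lemma param_generic_inj : exists B : seq 'rV[K]_3,
  forall t t' c, point_at a t = c *: point_at a t' ->
  t = t' \/ exists2 b, b \in B & exists c, point_at a t = c *: b.
Proof.
have [_ im [B BP]] := f_proper; exists (map (@rep_vec K 2) B) => t t' c e.
have p0 s : point_at a s != 0 by rewrite trmx_eq0 param_base_free.
have [P Pt] := pspace_of (p0 t).
case: (boolP (P \in B)) => [PB|/BP h]; [right|left].
  exists (rep_vec P); first exact: map_f.
  by apply/mem_pspace; rewrite Pt memv_line.
have [|Q [_ Quniq]] := h.
  by apply/(vanishes_homog hF (p0 t) Pt); apply: param_image_zero.
have [Q1 Q1t] := pspace_of (st_neq0_l t); have [Q2 Q2t] := pspace_of (st_neq0_l t').
have /Quniq e1 : param_image a Q1 P by apply/(param_image_finite _ Q1t).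
have /Quniq e2 : param_image a Q2 P.
  apply/(param_image_finite _ Q2t); rewrite Pt e line_scale //.
  by apply: contraNneq (p0 t) => c0; rewrite e c0 scale0r.
have /(line_eqP (st_neq0_l t))[c' _] : <[st 1 t]>%VS = <[st 1 t']>%VS.
  by rewrite -Q1t -Q2t -e1 -e2.
rewrite stZ => /rowP E; have := E 0; have := E 1; rewrite !mxE /= mulr1 => -> <-.
by rewrite mul1r.
Qed.

Definition has_factor_at (k : nat) (P : pspace K 2) : Prop := has_factor a k (rep_vec P).

Lemma has_factor_scale k (v : 'rV[K]_3) c : c != 0 ->
  has_factor a k (c *: v) <-> has_factor a k v.
Proof.
move=> c0; have e (l : 'rV[K]_3) : (l *m (c *: v)^T == 0) = (l *m v^T == 0).
  by rewrite linearZ /= -scalemxAr scaler_eq0 (negbTE c0).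
split=> -[g [g0 sg gl]]; exists g; split=> // l /eqP lv; apply: gl; apply/eqP.
  by rewrite e.
by rewrite -e.
Qed.

Lemma multiplicity_factor P r : multiplicity F P r ->
  [/\ (r < n)%N, (forall k, (k <= n)%N -> has_factor_at k P <-> (k <= r)%N) &
    Sing F P <-> (2 <= r)%N].
Proof.
move=> [v [i [vP vi om]]].
have v0 : v != 0 by apply/rV0Pn; exists i; rewrite vi oner_eq0.
have Pv := mem_pspace_neq0 vP v0; have [c c0 e] := rep_vec_line v0 Pv.
have [B BP] := param_generic_inj.
have [rn hk] := order_factor charK hF irrF param_base_free param_base_free_infty
  param_zero_image param_image_zero BP param_image_zero_infty n_ge3 vi om.
split=> //; first by move=> k kn; rewrite /has_factor_at e; apply: iff_trans (hk k kn); apply: has_factor_scale.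
apply: iff_trans (sing_order vi hF om); split=> -[F0 dF0]; split.
- exact/(vanishes_homog hF v0 Pv).
- by move=> l; apply/(vanishes_homog (deriv_homog l hF) v0 Pv).
- exact/(vanishes_homog hF v0 Pv).
- by move=> l; apply/(vanishes_homog (deriv_homog l hF) v0 Pv).
Qed.

Lemma multiplicity_exists P : exists r, multiplicity F P r.
Proof.
have /rV0Pn[i Pi] := rep_vec_neq0 P; have [j [k [ij ik jk]]] := ord3_others i.
pose v := (rep_vec P 0 i)^-1 *: rep_vec P; have vi : v 0 i = 1 by rewrite mxE mulVf.
have [r om] := order_exists ij ik jk vi hF irrF.
by exists r, v, i; split=> //; apply/mem_pspace; exists (rep_vec P 0 i)^-1.
Qed.

Lemma SingP P : Sing F P <-> has_factor_at 2 P.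
Proof.
have [r rP] := multiplicity_exists P; have [_ hk hs] := multiplicity_factor rP.
by apply: iff_trans hs _; apply: iff_sym; apply: hk; apply: ltnW.
Qed.

Lemma Sing_multP k P : (2 <= k < n)%N ->
  Sing_mult F k P <-> has_factor_at k P /\ ~ has_factor_at k.+1 P.
Proof.
move=> /andP[k2 kn]; split=> [[_ kP]|[h1 h2]].
  have [_ hk _] := multiplicity_factor kP; split; first by apply/hk => //; apply: ltnW.
  by move/(hk _ kn); rewrite ltnn.
have [r rP] := multiplicity_exists P; have [_ hk hs] := multiplicity_factor rP.
have kr : (k <= r)%N by apply/hk => //; apply: ltnW.
have rk : r = k.
  apply/anti_leq; rewrite kr andbT leqNgt; apply/negP => rk.
  by apply: h2; apply/hk.
by split; [apply/hs; apply: leq_trans kr|rewrite -rk].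
Qed.

Lemma has_factor_at_le k k' P : (k <= k' <= n)%N -> has_factor_at k' P -> has_factor_at k P.
Proof. exact: has_factor_le. Qed.

Lemma no_full_factor_at P : ~ has_factor_at n P.
Proof.
have [r rP] := multiplicity_exists P; have [rn hk _] := multiplicity_factor rP.
by move/(hk _ (leqnn n)); rewrite leqNgt rn.
Qed.

Lemma has_factor_finite k : (2 <= k <= n)%N ->
  exists l : seq (pspace K 2), forall P, has_factor_at k P -> P \in l.
Proof.
move=> kn; have [B BP] := param_generic_inj.
have [S SP] := finite_double charK hF irrF param_base_free param_base_free_infty
  param_zero_image BP n_ge3.
have [l lP] : exists l : seq (pspace K 2), forall P, (exists2 b, b \in S &
    exists c, rep_vec P = c *: b) -> P \in l.
  elim: (S) => [|b S' [l lP]]; first by exists [::] => P [].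
  have [b0|b0] := eqVneq b 0.
    exists l => P [b']; rewrite inE => /orP[/eqP ->|b'S] [c e].
      by have := rep_vec_neq0 P; rewrite e b0 scaler0 eqxx.
    by apply: lP; exists b' => //; exists c.
  have [Q Qb] := pspace_of b0; exists (Q :: l) => P [b'].
  rewrite !inE => /orP[/eqP ->|b'S] [c e]; apply/orP; [left|right].
    apply/eqP/val_inj; rewrite /= (pspaceE P) e line_scale //.
    by apply: contraNneq (rep_vec_neq0 P) => c0; rewrite e c0 scale0r.
  by apply: lP; exists b' => //; exists c.
exists l => P kP; apply: lP; apply: SP; first exact: rep_vec_neq0.
exact: has_factor_at_le kP.
Qed.

Lemma JgeP k p : (0 < k <= n)%N ->
  Jge a k p <-> forall P, has_factor_at k P -> vanishes_at p P.
Proof.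
move=> /[dup] k0n /andP[k0 kn]; rewrite /Jge; case: (ltnP k n) => kn'; last first.
  (* For k = n the ideal is (1) by definition; this agrees with the right side because every
     multiplicity is less than n. *)
  have -> : k = n by apply/anti_leq; rewrite kn.
  by split=> // _ P /no_full_factor_at.
apply: iff_trans (elim_vanishP param_base_free param_base_free_infty k0n p) _.
split=> [h P kP v /mem_pspace[c ->]|h v v0 kv c].
  by apply: h kP c; apply: rep_vec_neq0.
have [P Pv] := pspace_of v0; have [c' c0 e] := rep_vec_line v0 Pv.
apply: (h P); last by rewrite Pv memvZ // memv_line.
by rewrite /has_factor_at e; apply/has_factor_scale.
Qed.

Lemma JeqP k p : (2 <= k < n)%N ->
  Jeq a k p <-> forall P, Sing_mult F k P -> vanishes_at p P.
Proof.
move=> /[dup] k2n /andP[k2 kn].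
have k0 : (0 < k <= n)%N by rewrite (ltnW k2) ltnW.
have k0' : (0 < k.+1 <= n)%N by [].
split=> [h P /(Sing_multP P k2n)[kP nkP]|h q /(JgeP _ k0') qP].
  have [l lP] : exists l : seq (pspace K 2), forall P, has_factor_at k.+1 P -> P \in l.
    by apply: has_factor_finite; rewrite ltnW.
  (* This form vanishes at the finitely many points of multiplicity at least k + 1 but not at P: it
     lies in [Jge a k.+1], and can be cancelled from p b at the nonzero multiples of P. *)
  have [b [hb bP bl]] := separating_form P (leqnn (size l)).
  have /h/(JgeP _ k0)/(_ P kP) pb : Jge a k.+1 b.
    apply/(JgeP _ k0') => Q Qk; apply/(vanishes_homog hb (rep_vec_neq0 Q) (pspaceE Q)).
    by apply: bl; [exact: lP|apply/eqP => QP; apply: nkP; rewrite -QP].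
  apply: vanishes_punctured => c c0; apply/eqP; have := pb (c *: rep_vec P).
  rewrite mevalM (dhomog_scale _ _ hb) bP mulr1 => e.
  have /eqP : p.@[(c *: rep_vec P) 0] * c ^+ size l = 0 by apply: e; apply/mem_pspace; exists c.
  by rewrite mulf_eq0 expf_eq0 (negbTE c0) andbF orbF.
apply/(JgeP _ k0) => P kP v vP; rewrite mevalM.
case: (classic (has_factor_at k.+1 P)) => kP'; first by rewrite (qP P) ?mulr0.
by rewrite (h P) ?mul0r //; apply/Sing_multP.
Qed.

Lemma card_hilbert (S : pspace K 2 -> Prop) (l : seq (pspace K 2)) I :
    (forall P, S P -> P \in l) ->
    (forall p, I p <-> forall P, S P -> vanishes_at p P) ->
  exists2 N, has_card S N & hilbert_poly I (N%:R)%:P.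
Proof.
move=> /finite_subset[s us sP] IP; exists (size s); first by exists s.
apply: hilbert_poly_points => // p; apply: iff_trans (IP p) _.
by split=> h P SP; apply: h; apply/sP.
Qed.

End Parameterized.

Theorem proposition3p17 (K : closedFieldType) (charK : [pchar K] =i pred0)
    (n : nat) (n_ge3 : (3 <= n)%N)
    (F : {mpoly K[3]}) (C_curve : plane_curve F)
    (a : 'M[K]_(3, n.+1)) (f_proper : proper_param a F) :
  [/\ forall p, Jge a 2 p <-> vanishing_ideal (Sing F) p,
      forall k : nat, (2 <= k <= n - 1)%N ->
        forall p, Jeq a k p <-> vanishing_ideal (Sing_mult F k) p,
      exists2 N : nat, has_card (Sing F) N &
        hilbert_poly (Jge a 2) (N%:R)%:P &
      forall k : nat, (2 <= k <= n - 1)%N ->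
        exists2 N : nat, has_card (Sing_mult F k) N &
          hilbert_poly (Jeq a k) (N%:R)%:P].
Proof.
have [[d hF] irrF] := C_curve.
have SP := SingP charK n_ge3 hF irrF f_proper.
have J2 p : Jge a 2 p <-> forall P, Sing F P -> vanishes_at p P.
  have k2 : (0 < 2 <= n)%N by exact: ltnW n_ge3.
  apply: iff_trans (JgeP charK n_ge3 hF irrF f_proper p k2) _.
  by split=> h P /SP; apply: h.
have kn k : (2 <= k <= n - 1)%N -> (2 <= k < n)%N by lia.
have Jk k : (2 <= k <= n - 1)%N -> forall p,
    Jeq a k p <-> forall P, Sing_mult F k P -> vanishes_at p P.
  by move=> /kn k2n p; apply: (JeqP charK n_ge3 hF irrF f_proper).
have k2 : (2 <= 2 <= n)%N by exact: ltnW n_ge3.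
have [l lP] := has_factor_finite charK n_ge3 hF irrF f_proper k2.
split.
- by move=> p; apply: iff_trans (J2 p) (iff_sym (vanishing_idealP _ p)).
- by move=> k kn' p; apply: iff_trans (Jk k kn' p) (iff_sym (vanishing_idealP _ p)).
- by apply: card_hilbert J2 => P /SP; apply: lP.
- by move=> k kn'; apply: card_hilbert (Jk k kn') => P [/SP SPP _]; apply: lP.
Qed.
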